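(* Let $M$ be a smooth compact connected Riemannian manifold without boundary and let $X\in\mathfrak{X}^1(M)$ be a $C^1$ vector field whose periodic orbits and singularities are all hyperbolic. Let $f\in\mathcal{Z}^1_{\mathrm{Diff}}(X)$ be an element of the $C^1$-centralizer with the following property: there exists a constant $T>0$ such that for every $p\in M$ we have $f(p)\in X_{[-T,T]}(p)$. Then there exists an $X$-invariant continuous function $\tau:M\to\mathbb{R}$ such that $f(x)=X_{\tau(x)}(x)$ for every $x\in M$.
   Context: $\mathfrak{X}^1(M)$ is the space of $C^1$ vector fields on $M$; $X_t$ is the time-$t$ map of the flow of $X$; $X_{[-T,T]}(p)=\{X_t(p): t\in[-T,T]\}$. $\mathcal{Z}^1_{\mathrm{Diff}}(X)=\{f\in\mathrm{Diff}^1(M): f\circ X_t=X_t\circ f \ \ \forall t\in\mathbb{R}\}$. A function $\tau$ is $X$-invariant if $\tau(X_t(x))=\tau(x)$ for all $t\in\mathbb{R}$ and all $x$. *)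

(* Defs.v *)
From HB Require Import structures.
From mathcomp Require Import all_boot all_order all_algebra.
From mathcomp Require Import all_classical all_reals all_analysis.
From mathcomp Require Import complex.

Set Implicit Arguments.
Unset Strict Implicit.
Unset Printing Implicit Defensive.

Import Order.TTheory GRing.Theory Num.Theory.
Import numFieldNormedType.Exports.

Local Open Scope classical_set_scope.
Local Open Scope ring_scope.

(* [Ck k U f]: f is of class C^k on U.  Only used with U open, so that
   differentiability at the points of U depends only on f restricted to U.
   In finite dimension, continuity of x |-> 'd f x v for every fixed v is
   continuity of x |-> 'd f x. *)
Fixpoint Ck (R : realType) (k : nat) (V W : normedModType R)
    (U : set V) (f : V -> W) : Prop :=
  match k with
  | 0%N => forall x, U x -> {for x, continuous f}
  | k'.+1 => (forall x, U x -> differentiable f x) /\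
             (forall v : V, Ck k' U (fun x => 'd f x v))
  end.

Definition Cinfty (R : realType) (V W : normedModType R)
    (U : set V) (f : V -> W) : Prop := forall k, Ck k U f.

(* The maps are total; [chart_map] is meaningful on [chart_dom] only, and
   [chart_inv] on the image of [chart_dom] only. *)
Record chart (R : realType) (n : nat) (M : topologicalType) := Chart {
  chart_dom : set M;
  chart_map : M -> 'rV[R]_n;
  chart_inv : 'rV[R]_n -> M;
  chart_dom_open : open chart_dom;
  chart_img_open : open (chart_map @` chart_dom);
  chart_map_cont : forall x, chart_dom x -> {for x, continuous chart_map};
  chart_inv_cont : forall y, (chart_map @` chart_dom) y ->
    {for y, continuous chart_inv};
  chart_mapK : forall x, chart_dom x -> chart_inv (chart_map x) = x }.

Definition transition (R : realType) (n : nat) (M : topologicalType)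
    (c c' : chart R n M) : 'rV[R]_n -> 'rV[R]_n :=
  chart_map c' \o chart_inv c.

(* M, with the atlas A, is a smooth n-dimensional manifold without boundary
   (the charts take values in open subsets of the whole of R^n). *)
Record smooth_manifold (R : realType) (n : nat) (M : topologicalType)
    (A : set (chart R n M)) : Prop := SmoothManifold {
  manifold_hausdorff : hausdorff_space M;
  manifold_second_countable : @second_countable M;
  manifold_cover : forall x : M, exists2 c, A c & chart_dom c x;
  manifold_smooth : forall c c', A c -> A c' ->
    Cinfty (chart_map c @` (chart_dom c `&` chart_dom c')) (transition c c') }.

(* A tensor field is given by its components in every chart of the atlas;
   the components at x in the chart c are meaningful only when x is in
   [chart_dom c].
   Tangent vectors are row vectors, so the differential of a map acts by right
   multiplication by its Jacobian 'J. *)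

Record riemannian_metric (R : realType) (n : nat) (M : topologicalType)
    (A : set (chart R n M)) (g : chart R n M -> M -> 'M[R]_n) : Prop :=
  RiemannianMetric {
  metric_sym : forall c x, A c -> chart_dom c x -> (g c x)^T = g c x;
  metric_pos : forall c x (v : 'rV[R]_n), A c -> chart_dom c x -> v != 0 ->
    0 < (v *m g c x *m v^T) 0 0;
  metric_change : forall c c' x, A c -> A c' ->
    chart_dom c x -> chart_dom c' x ->
    let J := 'J (transition c c') (chart_map c x) in
    g c x = J *m g c' x *m J^T;
  metric_smooth : forall c, A c ->
    Cinfty (chart_map c @` chart_dom c) (g c \o chart_inv c) }.

Record C1_vector_field (R : realType) (n : nat) (M : topologicalType)
    (A : set (chart R n M)) (X : chart R n M -> M -> 'rV[R]_n) : Prop :=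
  C1VectorField {
  field_change : forall c c' x, A c -> A c' ->
    chart_dom c x -> chart_dom c' x ->
    X c' x = X c x *m 'J (transition c c') (chart_map c x);
  field_C1 : forall c, A c ->
    Ck 1 (chart_map c @` chart_dom c) (X c \o chart_inv c) }.

Definition integral_curve (R : realType) (n : nat) (M : topologicalType)
    (A : set (chart R n M)) (X : chart R n M -> M -> 'rV[R]_n)
    (gamma : R -> M) : Prop :=
  continuous gamma /\
  forall c t, A c -> chart_dom c (gamma t) ->
    is_derive t 1 (chart_map c \o gamma) (X c (gamma t)).

Record flow_of (R : realType) (n : nat) (M : topologicalType)
    (A : set (chart R n M)) (X : chart R n M -> M -> 'rV[R]_n)
    (Phi : R -> M -> M) : Prop := FlowOf {
  flow0 : forall x, Phi 0 x = x;
  flowD : forall s t x, Phi (s + t) x = Phi s (Phi t x);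
  flow_integral : forall x, integral_curve A X (Phi^~ x) }.

Definition C1_map (R : realType) (n : nat) (M : topologicalType)
    (A : set (chart R n M)) (f : M -> M) : Prop :=
  continuous f /\
  forall c c', A c -> A c' ->
    Ck 1 (chart_map c @` (chart_dom c `&` f @^-1` chart_dom c'))
         (chart_map c' \o f \o chart_inv c).

Definition C1_diffeo (R : realType) (n : nat) (M : topologicalType)
    (A : set (chart R n M)) (f : M -> M) : Prop :=
  C1_map A f /\ exists g, [/\ cancel f g, cancel g f & C1_map A g].

Definition C1_centralizer (R : realType) (n : nat) (M : topologicalType)
    (A : set (chart R n M)) (Phi : R -> M -> M) : set (M -> M) :=
  [set f | C1_diffeo A f /\ forall t, f \o Phi t = Phi t \o f].

Definition complex_eigenvalue (R : realType) (n : nat) (J : 'M[R]_n)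
    (z : R[i]) : bool :=
  eigenvalue (map_mx (real_complex R) J) z.

Definition singularity (R : realType) (n : nat) (M : topologicalType)
    (A : set (chart R n M)) (X : chart R n M -> M -> 'rV[R]_n) (p : M) : Prop :=
  forall c, A c -> chart_dom c p -> X c p = 0.

Definition hyperbolic_singularity (R : realType) (n : nat) (M : topologicalType)
    (A : set (chart R n M)) (X : chart R n M -> M -> 'rV[R]_n) (p : M) : Prop :=
  singularity A X p /\
  forall c z, A c -> chart_dom c p ->
    complex_eigenvalue ('J (X c \o chart_inv c) (chart_map c p)) z ->
    complex.Re z != 0.

(* P is the minimal period of p; in particular p is not a singularity. *)
Definition is_period (R : realType) (M : topologicalType)
    (Phi : R -> M -> M) (p : M) (P : R) : Prop :=
  [/\ 0 < P, Phi P p = p & forall s, 0 < s < P -> Phi s p <> p].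

(* The eigenvalue 1 of D X_P(p), in the direction X(p), is simple and no other
   eigenvalue has modulus 1. *)
Definition hyperbolic_periodic (R : realType) (n : nat) (M : topologicalType)
    (A : set (chart R n M)) (Phi : R -> M -> M) (p : M) (P : R) : Prop :=
  is_period Phi p P /\
  forall c, A c -> chart_dom c p ->
    let J := 'J (chart_map c \o Phi P \o chart_inv c) (chart_map c p) in
    mup 1 (char_poly J) = 1%N /\
    forall z, complex_eigenvalue J z -> z != 1 -> `|z| != 1.

Definition all_critical_hyperbolic (R : realType) (n : nat)
    (M : topologicalType) (A : set (chart R n M))
    (X : chart R n M -> M -> 'rV[R]_n) (Phi : R -> M -> M) : Prop :=
  (forall p, singularity A X p -> hyperbolic_singularity A X p) /\
  (forall p P, is_period Phi p P -> hyperbolic_periodic A Phi p P).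

(* Main.v *)
Require Import Defs.
From HB Require Import structures.
From mathcomp Require Import all_boot all_order all_algebra.
From mathcomp Require Import all_classical all_reals all_analysis.
From mathcomp Require Import complex.
From mathcomp Require Import ring lra.

Set Implicit Arguments.
Unset Strict Implicit.
Unset Printing Implicit Defensive.

Import Order.TTheory GRing.Theory Num.Theory.
Import numFieldNormedType.Exports.

Local Open Scope classical_set_scope.
Local Open Scope ring_scope.

(** Near a point p write f = Phi_t0 o g with g p = p, and pass to a chart.  If
    q -> p along a direction v outside the line of X(p) and g q = Phi_s q with s
    tending to some s', then Phi_s' p = p and Dg(p) v = D Phi_s'(p) v modulo
    X(p).  The differentials of g and of the Phi_s fixing p commute, and
    hyperbolicity says that D Phi_s(p), s <> 0, fixes no vector modulo X(p) other
    than multiples of X(p).  Comparing the times of v, w and v + w shows that s'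
    does not depend on v.  Hence the times t in [-T, T] with f q = Phi_t q
    converge as q tends to p off the orbit of p, to a limit time that is constant
    along the orbit, and taking this limit as tau p gives a continuous function.
    Singularities, periodic orbits and other points are treated uniformly. *)

(** * Linear algebra *)

(** A time t with f q = Phi_t q is determined only modulo the period on a periodic orbit, and not at
    all at a singularity, so tau p cannot be read off from p alone: it has to come from nearby
    orbits. Two obstacles shape the argument. An error r in the time moves Phi_(s+r) q by about r
    X(p), which need not be small compared with q - p; this is why linearizations are compared
    modulo the line of X(p) (nothing is divided out at a singularity). And if q approaches p along
    X(p), this comparison says nothing; since f commutes with the flow, a time for q is a time for
    its whole orbit, and q can first be moved along its orbit into a hyperplane transverse to X(p).
    Limits of times are not extracted from sequences: each wrong time t of the compact interval is
    excluded, together with the times near t, for all q near p, and compactness excludes them all at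
    once. *)

Lemma stable_eigenvector (C : numClosedFieldType) n (A W : 'M[C]_n) :
  W != 0 -> stablemx W A ->
  exists (z : C) (w : 'rV_n), [/\ w != 0, (w <= W)%MS & w *m A = z *: w].
Proof.
move=> W0 sWA.
have rW : (0 < \rank W)%N by rewrite lt0n mxrank_eq0.
have [z /eigenvalueP[u uA u0]] := eigenvalue_closed (restrictmx W A) rW.
exists z, (u *m row_base W); split.
- by rewrite mulmx_free_eq0 // row_base_free.
- by rewrite (submx_trans (submxMl _ _)) // eq_row_base.
- rewrite scalemxAl -uA -[in RHS]mulmxA mulmxKpV ?mulmxA //.
  by rewrite stablemx_row_base.
Qed.

(** In a basis that extends the rows of [V], [J] becomes block lower triangular with [T] as upper
    left block. *)
Lemma char_poly_stable_dvd (F : fieldType) m k (V : 'M[F]_(m, m + k))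
    (J : 'M[F]_(m + k)) (T : 'M[F]_m) :
  row_free V -> V *m J = T *m V -> char_poly T %| char_poly J.
Proof.
move=> fV VJ.
have rV : \rank V = m by apply/eqP.
(* Gaussian elimination writes [V] as [col_ebase V] times the first m rows of [row_ebase V], so [V]
   is the upper part of the invertible matrix [P]. *)
pose P := block_mx (col_ebase V) 0 0 1%:M *m row_ebase V.
have uP : P \in unitmx.
  rewrite unitmx_mul row_ebase_unit andbT unitmxE det_lblock det1 mulr1 -unitmxE.
  exact: col_ebase_unit.
have PV : usubmx P = V.
  rewrite /P block_mxEv mul_col_mx col_mxKu -{3}(mulmx_ebase V).
  congr (_ *m _); rewrite rV pid_mx_row.
  by rewrite mul_mx_row mulmx1 mulmx0.
move: (P) uP PV => {}P uP PV.
pose Q := P *m J *m invmx P.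
have QP : P *m J = Q *m P by rewrite /Q mulmxKV.
have Qu : usubmx Q = row_mx T 0.
  rewrite /Q -!mul_usub_mx PV VJ -mulmxA -PV mul_usub_mx mulmxV //.
  by rewrite (scalar_mx_block m k 1) block_mxEv col_mxKu mul_mx_row mulmx1 mulmx0.
have cJ : char_poly J = char_poly Q.
  have detP : \det (map_mx polyC P) != 0.
    by rewrite det_map_mx polyC_eq0 -unitfE -unitmxE.
  apply: (mulfI detP); rewrite /char_poly [RHS]mulrC -!det_mulmx.
  congr (\det _); rewrite /char_poly_mx mulmxBr mulmxBl scalar_mxC.
  by rewrite -!map_mxM QP.
rewrite cJ -[Q]submxK /ulsubmx /ursubmx Qu row_mxKl row_mxKr.
rewrite /char_poly /char_poly_mx map_block_mx map_mx0.
rewrite (scalar_mx_block _ _ 'X) opp_block_mx add_block_mx oppr0 addr0.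
by rewrite det_lblock dvdp_mulr.
Qed.

(** If v were not a multiple of e, the two would span a stable plane on which [J] is triangular with
    diagonal a, a, and (X - a)^2 would divide the characteristic polynomial; this includes c = 0. *)
Lemma mup_jordan (F : fieldType) n (J : 'M[F]_n) (a c : F) (e v : 'rV[F]_n) :
  e != 0 -> e *m J = a *: e -> v *m J = a *: v + c *: e ->
  (mup a (char_poly J) <= 1)%N -> exists b, v = b *: e.
Proof.
move=> e0 eJ vJ mu; apply: contrapT => nv.
have fV : row_free (col_mx e v : 'M[F]_(1 + 1, n)).
  apply/row_freeP; apply/row_freeP/inj_row_free => u.
  rewrite -[u]hsubmxK mul_row_col.
  rewrite [lsubmx u]mx11_scalar [rsubmx u]mx11_scalar !mul_scalar_mx.
  set x := lsubmx _ _ _; set y := rsubmx _ _ _ => E.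
  have y0 : y = 0.
    apply: contrapT => /eqP y0; apply: nv; exists (- y^-1 * x).
    apply: (scalerI y0); rewrite scalerA mulrA mulrN divff // mulN1r scaleNr.
    by apply/eqP; rewrite -addr_eq0 addrC E.
  move: E; rewrite y0 scale0r addr0 => /eqP; rewrite scaler_eq0 (negPf e0) orbF.
  by move=> /eqP->; rewrite raddf0 row_mx0.
have le2n : (2 <= n)%N by have := rank_leq_col (col_mx e v); rewrite (eqP fV).
move: n J e v e0 eJ vJ mu nv fV le2n => [|[|k]] // J e v e0 eJ vJ mu nv fV _.
pose T : 'M[F]_(1 + 1) := block_mx a%:M 0 c%:M a%:M.
have VJ : (col_mx e v : 'M[F]_(1 + 1, 2 + k)) *m J = T *m col_mx e v.
  rewrite mul_col_mx mul_block_col !mul_scalar_mx mul0mx addr0 eJ vJ.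
  by rewrite [c *: e + _]addrC.
have := @char_poly_stable_dvd _ 2 k _ _ _ fV VJ.
have -> : char_poly T = ('X - a%:P) ^+ 2.
  rewrite /T /char_poly /char_poly_mx map_block_mx map_mx0.
  rewrite (scalar_mx_block _ _ 'X) opp_block_mx add_block_mx oppr0 addr0.
  by rewrite det_lblock !map_scalar_mx -!raddfB !det_scalar1 expr2.
by rewrite -mup_geq ?monic_neq0 ?char_poly_monic // leqNgt ltnS mu.
Qed.

(* With S = 1 + J + ... + J^(m-1), the hypothesis on v reads
   (vJ - v - (a/m) e) S = 0, and S is invertible since a kernel vector of S
   would give an eigenvalue z <> 1 of J with z^m = 1. *)
Lemma hyperbolic_power_fixed (R : rcfType) n (J : 'M[R]_n) (e v : 'rV[R]_n)
    (m : nat) (a : R) :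
  e != 0 -> e *m J = e -> mup 1 (char_poly J) = 1%N ->
  (forall z : R[i], eigenvalue (map_mx (real_complex R) J) z ->
     z != 1 -> `|z| != 1) ->
  (0 < m)%N -> v *m J ^+ m = v + a *: e -> exists b, v = b *: e.
Proof.
move=> e0 eJ mu hyp m0 vJ.
pose S := \sum_(k < m) J ^+ k.
have eS : e *m S = m%:R *: e.
  rewrite mulmx_sumr (eq_bigr (fun=> e)) ?sumr_const ?card_ord ?scaler_nat //.
  move=> k _; elim: (nat_of_ord k) => [|j IH]; first by rewrite mulmx1.
  by rewrite exprSr mulmxA IH.
have m0' : m%:R != 0 :> R by rewrite pnatr_eq0 -lt0n.
have vS : (v *m J - v) *m S = a *: e.
  have : v *m J ^+ m - v = a *: e by rewrite vJ addrC addKr.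
  rewrite -{2}[v]mulmx1 -mulmxBr -[1%:M]/(1 : 'M[R]_n) subrX1 => <-.
  by rewrite mulmxA mulmxBr mulmx1.
have JS : comm_mx J S.
  by apply: comm_mx_sum => k _; apply: commrX.
have kS : kermx S = 0.
  apply/eqP/negPn/negP => kS0.
  pose rc := real_complex R.
  have kSC : kermx (map_mx rc S) != 0.
    by rewrite -map_kermx map_mx_eq0.
  have sK : stablemx (kermx (map_mx rc S)) (map_mx rc J).
    apply: comm_mx_stable_ker; rewrite /comm_mx -!map_mxM; congr map_mx.
    by [].
  have [z [w [w0 /sub_kermxP wS wJ]]] := stable_eigenvector kSC sK.
  have wSz : w *m map_mx rc S = (\sum_(k < m) z ^+ k) *: w.
    rewrite map_mx_sum mulmx_sumr scaler_suml; apply: eq_bigr => k _.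
    elim: (nat_of_ord k) => [|j IH]; first by rewrite expr0 map_mx1 mulmx1 scale1r.
    rewrite exprSr map_mxM mulmxA IH -scalemxAl wJ scalerA.
    by rewrite exprSr.
  have sz : \sum_(k < m) z ^+ k = 0.
    by apply/eqP; move/eqP: wSz; rewrite wS eq_sym scaler_eq0 (negPf w0) orbF.
  have zm : z ^+ m = 1 by apply/eqP; rewrite -subr_eq0 subrX1 sz mulr0.
  have z1 : z != 1.
    apply/eqP => z1; move: sz; rewrite z1 => /eqP.
    rewrite (eq_bigr (fun=> 1)); last by move=> k _; rewrite expr1n.
    by rewrite sumr_const card_ord pnatr_eq0 -leqn0 leqNgt m0.
  have zJ : eigenvalue (map_mx rc J) z by apply/eigenvalueP; exists w.
  have /negP := hyp z zJ z1; apply.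
  by rewrite -(@pexpr_eq1 _ _ m) // -normrX zm normr1.
have E : (v *m J - v - (a / m%:R) *: e) *m S = 0.
  by rewrite mulmxBl vS -scalemxAl eS scalerA divfK // subrr.
have {}E : v *m J = 1 *: v + (a / m%:R) *: e.
  move/sub_kermxP: E; rewrite kS submx0 subr_eq0 => /eqP E.
  by rewrite -E scale1r addrC subrK.
by apply: (mup_jordan e0 _ E); rewrite ?scale1r // mu.
Qed.

Lemma mxDE (R : nmodType) m n (A B : 'M[R]_(m, n)) i j :
  (A + B) i j = A i j + B i j.
Proof. by rewrite mxE. Qed.

Lemma mxNE (R : zmodType) m n (A : 'M[R]_(m, n)) i j : (- A) i j = - A i j.
Proof. by rewrite mxE. Qed.

Lemma mxZE (R : pzRingType) m n (a : R) (A : 'M[R]_(m, n)) i j : (a *: A) i j = a * A i j.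
Proof. by rewrite mxE. Qed.

Ltac rowring := apply/rowP => ?; rewrite !(mxDE, mxNE, mxZE); ring.

(* If r, s, t are times for v, w, v + w then u = v (J t - J s) agrees with
   w (J r - J t) modulo e, so B acts on u both as J s and as J r. *)
Lemma common_time (R : rcfType) n (G : R -> Prop) (J : R -> 'M[R]_n)
    (B : 'M[R]_n) (e : 'rV[R]_n) :
  (forall s r, G s -> G r -> G (s - r)) -> J 0 = 1%:M ->
  (forall s r, G s -> G r -> J (s + r) = J s *m J r) ->
  (forall s, G s -> B *m J s = J s *m B) ->
  (forall s, G s -> e *m J s = e) -> e *m B = e ->
  (forall s (v : 'rV_n), G s -> s != 0 -> (v *m J s - v <= e)%MS -> (v <= e)%MS) ->
  (forall v : 'rV_n, exists2 s, G s & (v *m B - v *m J s <= e)%MS) ->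
  forall s r (v w : 'rV_n), G s -> G r -> ~~ (v <= e)%MS -> ~~ (w <= e)%MS ->
  (v *m B - v *m J s <= e)%MS -> (w *m B - w *m J r <= e)%MS -> s = r.
Proof.
move=> GB J0 JD BJ eJ eB free every s r v w Gs Gr ve we Hv Hw.
have [t Gt Ht] := every (v + w).
have G0 : G 0 by rewrite -(subrr s); apply: GB.
have GN x : G x -> G (- x) by move=> Gx; rewrite -(add0r (- x)); apply: GB.
have eD (x y : 'rV[R]_n) : (x <= e)%MS -> (y <= e)%MS -> ((x + y)%R <= e)%MS.
  by move=> xe ye; rewrite addmx_sub.
have eN (x : 'rV[R]_n) : (x <= e)%MS -> (- x <= e)%MS by rewrite eqmx_opp.
have eMJ (x : 'rV[R]_n) y : G y -> (x <= e)%MS -> (x *m J y <= e)%MS.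
  by move=> Gy /(submxMr (J y)); rewrite eJ.
have eMB (x : 'rV[R]_n) : (x <= e)%MS -> (x *m B <= e)%MS.
  by move/(submxMr B); rewrite eB.
have JC x y : G x -> G y -> J x *m J y = J y *m J x.
  by move=> Gx Gy; rewrite -!JD // addrC.
have cancelJ (x : 'rV[R]_n) a b : G a -> G b -> (x *m J a - x *m J b <= e)%MS ->
    ~~ (x <= e)%MS -> a = b.
  move=> Ga Gb; have GNb := GN _ Gb.
  move=> /(eMJ _ _ GNb); rewrite mulmxBl -!mulmxA -!JD //.
  rewrite subrr J0 mulmx1 => H; apply: contraNeq => ab.
  by apply: free H; [exact: GB|rewrite subr_eq0].
pose u := v *m J t - v *m J s; pose u' := w *m J r - w *m J t.
have uu' : (u - u' <= e)%MS.
  have -> : u - u' = (v *m B - v *m J s) + (w *m B - w *m J r)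
     - ((v + w) *m B - (v + w) *m J t).
    by rewrite /u /u' !mulmxDl; rowring.
  by apply: (eD); [exact: (eD)|exact: eN].
have uB : (u *m B - u *m J s <= e)%MS.
  have -> : u *m B - u *m J s =
      (v *m B - v *m J s) *m J t - (v *m B - v *m J s) *m J s.
    rewrite /u !mulmxBl -!mulmxA (BJ t Gt) (BJ s Gs) (JC t s Gt Gs).
    by rowring.
  by apply: (eD); [exact: eMJ|apply: eN; exact: eMJ].
have u'B : (u' *m B - u' *m J r <= e)%MS.
  have -> : u' *m B - u' *m J r =
      (w *m B - w *m J r) *m J r - (w *m B - w *m J r) *m J t.
    rewrite /u' !mulmxBl -!mulmxA (BJ t Gt) (BJ r Gr) (JC t r Gt Gr).
    by rowring.
  by apply: (eD); [exact: eMJ|apply: eN; exact: eMJ].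
have uJ : (u *m J s - u *m J r <= e)%MS.
  have -> : u *m J s - u *m J r = - (u *m B - u *m J s) + (u - u') *m B
      + (u' *m B - u' *m J r) - (u - u') *m J r.
    by rewrite !mulmxBl; rowring.
  apply: (eD); last by apply: eN; exact: eMJ.
  apply: (eD) => //; apply: (eD); [exact: eN|exact: eMB].
(* If u is outside the line of e, [uJ] gives s = r directly. Otherwise u' is in the line too, so
   that t and s act alike on v, r and t act alike on w, and s = t = r. *)
have [ue|] := boolP (u <= e)%MS; last exact: cancelJ uJ.
have ts : t = s by apply: cancelJ ue ve.
have u'e : (u' <= e)%MS by rewrite -(subKr u u'); apply: (eD) => //; exact: eN.
by rewrite -ts; apply/esym; apply: cancelJ u'e we.
Qed.

Lemma eigenvector_ReIm (R : rcfType) n (A : 'M[R]_n) (z : R[i]) (w : 'rV[R[i]]_n) :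
  let a := map_mx (@complex.Re R) w in let b := map_mx (@complex.Im R) w in
  w *m map_mx (real_complex R) A = z *: w ->
  a *m A = complex.Re z *: a - complex.Im z *: b /\
  b *m A = complex.Im z *: a + complex.Re z *: b.
Proof.
move=> a b wA.
have ReM (M : 'M[R]_n) : map_mx (@complex.Re R) (w *m map_mx (real_complex R) M) = a *m M.
  apply/rowP => j; rewrite !mxE raddf_sum; apply: eq_bigr => k _.
  by rewrite !mxE; case: (w 0 k) => x y /=; rewrite !mulr0 subr0.
have ImM (M : 'M[R]_n) : map_mx (@complex.Im R) (w *m map_mx (real_complex R) M) = b *m M.
  apply/rowP => j; rewrite !mxE raddf_sum; apply: eq_bigr => k _.
  by rewrite !mxE; case: (w 0 k) => x y /=; rewrite !mulr0 add0r.
rewrite -ReM -ImM wA; split; apply/rowP => j; rewrite !mxE; case: (z) (w 0 j) => x y [x' y'] //=.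
by rewrite addrC.
Qed.

(** * Calculus for row vectors *)

Lemma mx_entry_le (R : realType) m n (x : 'M[R]_(m, n)) i j : `|x i j| <= `|x|.
Proof.
rewrite [leRHS]/Num.Def.normr/= mx_normrE.
exact: (le_bigmax _ (fun k => `|x k.1 k.2|) (i, j)).
Qed.

Lemma mx_norm_le (R : realType) m n (x : 'M[R]_(m, n)) C :
  0 <= C -> (forall i j, `|x i j| <= C) -> `|x| <= C.
Proof.
move=> C0 H; rewrite [leLHS]/Num.Def.normr/= mx_normrE.
by apply: bigmax_le => // -[i j] _; exact: H.
Qed.

Lemma mulmx_norm_le (R : realType) m n (v : 'rV[R]_m) (M : 'M[R]_(m, n)) :
  `|v *m M| <= m%:R * `|M| * `|v|.
Proof.
apply: mx_norm_le => [|i j]; first by rewrite !mulr_ge0.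
rewrite mxE (le_trans (ler_norm_sum _ _ _)) //.
rewrite (@le_trans _ _ (\sum_(k < m) `|M| * `|v|)) //.
  apply: ler_sum => k _; rewrite normrM mulrC ler_pM //; exact: mx_entry_le.
by rewrite sumr_const card_ord -mulrA mulr_natl.
Qed.

Lemma mulmxr_continuous (R : realType) m n (M : 'M[R]_(m, n)) :
  continuous (mulmxr M : 'rV[R]_m -> 'rV[R]_n).
Proof.
apply: bounded_linear_continuous; apply/linear_boundedP.
near=> k => v; rewrite /= (le_trans (mulmx_norm_le _ _)) // ler_wpM2r //.
Unshelve. all: by end_near. Qed.

Section Differential.
Context {R : realType} {V W : normedModType R}.

Lemma differentiable_approx (f : V -> W) x : differentiable f x ->
  forall e : R, 0 < e ->
  \forall y \near x, `|f y - f x - 'd f x (y - x)| <= e * `|y - x|.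
Proof.
move=> /diffP[_ H] e e0.
have /eqaddoP/(_ _ e0) : f = (fun y => f x + 'd f x (y - x)) +o_x (center x).
  by apply/funext => y; rewrite H lim_id.
by apply: filterS => y; rewrite /= opprD addrA.
Qed.

Lemma approx_differentiable (f : V -> W) x (L : {linear V -> W}) :
  continuous L ->
  (forall e : R, 0 < e ->
    \forall y \near x, `|f y - f x - L (y - x)| <= e * `|y - x|) ->
  differentiable f x /\ 'd f x = L :> (V -> W).
Proof.
move=> cL H.
have E : f \o shift x = cst (f x) + L +o_ 0 id.
  apply/eqaddoP => e e0; have /= := H e e0.
  rewrite (near_shift 0) subr0; apply: filterS => y /=.
  by rewrite addrK opprD addrA.
have dL := diff_unique cL E; split=> //.
by apply/diff_locallyP; rewrite dL.
Qed.

End Differential.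

(* Locked, since unification otherwise unfolds 'J down to its definition by
   choice. *)
HB.lock Definition jac (R : realType) m n (f : 'rV[R]_m -> 'rV[R]_n) x :
  'M[R]_(m, n) := 'J f x.
Canonical jac_unlockable := Unlockable jac.unlock.

Lemma jacE (R : realType) m n (f : 'rV[R]_m -> 'rV[R]_n) x v :
  v *m jac f x = 'd f x v.
Proof. by rewrite unlock /jacobian mul_rV_lin1. Qed.

Lemma differentiable_rVP (R : realType) m n (f : 'rV[R]_m -> 'rV[R]_n) x
    (M : 'M[R]_(m, n)) :
  (differentiable f x /\ jac f x = M) <->
  (forall e : R, 0 < e ->
    \forall y \near x, `|f y - f x - (y - x) *m M| <= e * `|y - x|).
Proof.
split=> [[df <-] e e0|H].
  by apply: filterS (differentiable_approx df e0) => y; rewrite jacE.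
have [df E] := approx_differentiable (@mulmxr_continuous R m n M) H.
by split=> //; apply/row_matrixP => i; rewrite !rowE jacE E.
Qed.

Lemma jac_comp (R : realType) m n p (f : 'rV[R]_m -> 'rV[R]_n)
    (g : 'rV[R]_n -> 'rV[R]_p) x :
  differentiable f x -> differentiable g (f x) ->
  differentiable (g \o f) x /\ jac (g \o f) x = jac f x *m jac g (f x).
Proof.
move=> df dg; split; first exact: differentiable_comp.
by apply/row_matrixP => i; rewrite !rowE mulmxA !jacE diff_comp.
Qed.

Lemma jac_near (R : realType) m n (f g : 'rV[R]_m -> 'rV[R]_n) x :
  {near x, f =1 g} -> differentiable f x ->
  differentiable g x /\ jac g x = jac f x.
Proof.
move=> fg df; apply/differentiable_rVP => e e0.
have /differentiable_rVP/(_ e e0) H : differentiable f x /\ jac f x = jac f x by [].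
have fgx := nbhs_singleton fg.
by near=> y; rewrite -fgx -(near fg y) //; near: y.
Unshelve. all: by end_near. Qed.

Lemma is_derive_comp_rV (R : realType) m n (f : 'rV[R]_m -> 'rV[R]_n)
    (g : R -> 'rV[R]_m) (t : R) v :
  is_derive t 1 g v -> differentiable f (g t) ->
  is_derive t 1 (f \o g) (v *m jac f (g t)).
Proof.
move=> [dg gv] df; have {}dg : differentiable g t by apply/derivable1_diffP.
apply: DeriveDef; first by apply/derivable1_diffP; exact: differentiable_comp.
rewrite deriveE; last exact: differentiable_comp.
by rewrite diff_comp //= jacE -(deriveE _ dg) gv.
Qed.

Lemma mx_distrC (R : realType) m n (x y : 'M[R]_(m, n)) : `|x - y| = `|y - x|.
Proof. exact: distrC. Qed.

Lemma is_derive_scalel (R : realType) (V : normedModType R) (t : R) (v : V) :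
  is_derive t 1 (fun s : R => s *: v) v.
Proof.
apply: DeriveDef; first exact: diff_derivable.
by rewrite deriveE // diff_val /= scale1r.
Qed.

Lemma is_derive_entry (R : realType) m n (g : R -> 'M[R]_(m, n)) (t : R) v i j :
  is_derive t 1 g v -> is_derive t 1 (fun s => g s i j : R) (v i j).
Proof.
move=> [dg <-]; apply: DeriveDef; first exact: (derivable_mxP g t 1).1.
by rewrite derive_mx // mxE.
Qed.

Lemma is_derive_continuous (R : realType) (V : normedModType R) (g : R -> V) (t : R) v :
  is_derive t 1 g v -> {for t, continuous g}.
Proof. by move=> [dg _]; exact/differentiable_continuous/derivable1_diffP. Qed.

(** The norm is the maximum of the entries, so the scalar mean value theorem in each entry gives the
    constant C without loss. *)
Lemma mean_value_ineq (R : realType) n (g g' : R -> 'rV[R]_n) (a b C : R) :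
  a <= b -> (forall t : R, a <= t <= b -> is_derive t 1 g (g' t)) ->
  (forall t : R, a <= t <= b -> `|g' t| <= C) -> `|g b - g a| <= C * (b - a).
Proof.
move=> ab dg gC.
have C0 : 0 <= C by rewrite (le_trans _ (gC a _)) ?lexx.
apply: mx_norm_le => [|i j]; first by rewrite mulr_ge0 ?subr_ge0.
have dgi t : t \in `[a, b] -> is_derive t 1 (fun s => g s i j : R) (g' t i j).
  by rewrite in_itv => tab; apply/is_derive_entry/dg.
have dgi' (t : R) : t \in `]a, b[ -> is_derive t 1 (fun s => g s i j : R) (g' t i j).
  by move=> tab; apply: dgi; exact: subset_itv_oo_cc.
have cgi : {within `[a, b], continuous (fun s => g s i j : R)}.
  by apply: derivable_within_continuous => t tab; have [] := dgi t tab.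
have [c cab E] := MVT_segment ab dgi' cgi.
rewrite !mxE {}E; rewrite normrM [`|b - a|]ger0_norm ?subr_ge0 //.
by rewrite ler_wpM2r ?subr_ge0 // (le_trans (mx_entry_le _ _ _)) // gC.
Qed.

(* Bounding |g| by its maximum over [0, 1] replaces Gronwall's exponential for
   short times. *)
Lemma short_gronwall (R : realType) n (g g' : R -> 'rV[R]_n) (K r : R) :
  0 <= K <= 2^-1 -> 0 <= r ->
  (forall t : R, 0 <= t <= 1 -> is_derive t 1 g (g' t)) ->
  (forall t : R, 0 <= t <= 1 -> `|g' t| <= K * `|g t| + r) ->
  forall t : R, 0 <= t <= 1 -> `|g t| <= 2 * (`|g 0| + r).
Proof.
move=> /andP[K0 K2] r0 dg gK.
have [|c c01 cmax] := @EVT_max R (fun t => `|g t|) 0 1 ler01.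
  apply/continuous_within_itvP => //.
  have cg t : 0 <= t <= 1 -> {for t, continuous (fun s => `|g s|)}.
    move=> /dg/is_derive_continuous cgt.
    by apply: (@continuous_comp _ _ _ g (fun x => `|x|)); [|exact: norm_continuous].
  split=> [t|  |].
  - by rewrite in_itv /= => /andP[/ltW ? /ltW ?]; apply: cg; apply/andP.
  - by apply: cvg_at_right_filter; apply: cg; rewrite lexx ler01.
  - by apply: cvg_at_left_filter; apply: cg; rewrite lexx ler01.
move: c01; rewrite in_itv /= => /andP[c0 c1].
have gmax t : 0 <= t <= 1 -> `|g t| <= `|g c| by move=> ?; apply: cmax; rewrite in_itv.
suff gc : `|g c| <= 2 * (`|g 0| + r) by move=> t /gmax /le_trans; apply.
have : `|g c - g 0| <= (K * `|g c| + r) * (c - 0).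
  apply: (@mean_value_ineq _ _ g g') => // t /andP[t0 tc];
    have t01 : 0 <= t <= 1 by rewrite t0 (le_trans tc).
    exact: dg.
  by rewrite (le_trans (gK _ t01)) // lerD2r ler_wpM2l // gmax.
rewrite subr0 => H.
have {}H : `|g c - g 0| <= 2^-1 * `|g c| + r.
  apply: (le_trans H); rewrite (@le_trans _ _ (K * `|g c| + r)) //.
    by rewrite ler_piMr // addr_ge0 // mulr_ge0.
  by rewrite lerD2r ler_wpM2r.
have := ler_normD (g c - g 0) (g 0); rewrite subrK => H'.
have := le_trans H' (lerD H (lexx _)) => {H H'}; lra.
Qed.

Lemma C1_jac_near (R : realType) m n (U : set 'rV[R]_m) (Y : 'rV[R]_m -> 'rV[R]_n) x0 :
  Ck 1 U Y -> U x0 -> forall e : R, 0 < e ->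
  \forall x \near x0, `|jac Y x - jac Y x0| <= e.
Proof.
move=> [_ cY] Ux0 e e0.
have H : \forall x \near x0, forall i : 'I_m, `|'d Y x (delta_mx 0 i) - 'd Y x0 (delta_mx 0 i)| <= e.
  have Hi (i : 'I_m) : \forall x \near x0, `|'d Y x (delta_mx 0 i) - 'd Y x0 (delta_mx 0 i)| <= e;
    last exact: filter_forall Hi.
  by have /cvgr_distC_le/(_ e e0) := cY (delta_mx 0 i) x0 Ux0.
apply: filterS H => x H; apply: mx_norm_le => [|i j]; first exact: ltW.
have Hr : `|row i (jac Y x) - row i (jac Y x0)| <= e by rewrite !rowE !jacE; exact: H.
apply: le_trans Hr.
have -> : (jac Y x - jac Y x0) i j = (row i (jac Y x) - row i (jac Y x0)) 0 j by rewrite !mxE.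
exact: mx_entry_le.
Qed.

(** Strict differentiability, from the mean value inequality for [Y] minus a linear map along the
    segment from b to a. *)
Lemma C1_strict (R : realType) m n (U : set 'rV[R]_m) (Y : 'rV[R]_m -> 'rV[R]_n) x0 :
  open U -> Ck 1 U Y -> U x0 -> forall e : R, 0 < e ->
  exists2 r, 0 < r & forall a b c : 'rV[R]_m, `|a - x0| < r -> `|b - x0| < r -> `|c - x0| < r ->
    `|Y a - Y b - (a - b) *m jac Y c| <= e * `|a - b|.
Proof.
(* The 2 pays for comparing two Jacobians through the one at x0, and m + 1 for the factor m of
   [mulmx_norm_le] (it stays positive when m = 0). *)
move=> oU C1Y Ux0 e e0; pose e' := e / (2 * m.+1%:R).
have e'0 : 0 < e' by rewrite divr_gt0 // mulr_gt0.
have : \forall x \near x0, U x /\ `|jac Y x - jac Y x0| <= e'.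
  by near=> x; split; near: x; [exact: open_nbhs_nbhs|exact: (C1_jac_near C1Y)].
move=> /nbhs_normP[r /= r0 H]; exists r => // a b c ar br cr.
have Hr x : `|x - x0| < r -> U x /\ `|jac Y x - jac Y x0| <= e'.
  by move=> xr; apply: H; rewrite /= distrC.
pose p (t : R) := b + t *: (a - b).
have pr t : 0 <= t <= 1 -> `|p t - x0| < r.
  move=> /andP[t0 t1].
  have -> : p t - x0 = (1 - t) *: (b - x0) + t *: (a - x0).
    by rewrite /p; apply/rowP => i; rewrite !mxE; ring.
  rewrite (le_lt_trans (ler_normD _ _)) // !normrZ !ger0_norm ?subr_ge0 //.
  have [->|tn0] := eqVneq t 0; first by rewrite mul0r addr0 subr0 mul1r.
  rewrite (@lt_le_trans _ _ ((1 - t) * r + t * r)) //; last by rewrite -mulrDl subrK mul1r.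
  by rewrite ler_ltD // ?ler_wpM2l ?subr_ge0 ?(ltW br) // ltr_pM2l // lt0r tn0.
have dp (t : R) : is_derive t 1 p (a - b).
  by rewrite -[a - b]add0r; apply: is_deriveD; exact: is_derive_scalel.
pose G t := (Y \o p) t - t *: ((a - b) *m jac Y c).
have dG (t : R) : 0 <= t <= 1 -> is_derive t 1 G ((a - b) *m (jac Y (p t) - jac Y c)).
  move=> /pr/Hr[Upt _]; rewrite mulmxBr; apply: is_deriveB.
    by apply: is_derive_comp_rV; exact: C1Y.1.
  exact: is_derive_scalel.
have := @mean_value_ineq _ _ G _ 0 1 (e * `|a - b|) ler01 dG.
have -> : G 1 - G 0 = Y a - Y b - (a - b) *m jac Y c.
  by rewrite /G /p /= !scale1r !scale0r subr0 addr0 [b + _]addrC subrK addrAC.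
rewrite subr0 mulr1; apply.
move=> t /pr/Hr[_ Ht]; rewrite (le_trans (mulmx_norm_le _ _)) // ler_wpM2r //.
have [_ Hc] := Hr c cr.
have D : `|jac Y (p t) - jac Y c| <= 2 * e'.
  rewrite -(subrKA (jac Y x0)) (le_trans (ler_normD _ _)) //.
  by rewrite (mx_distrC (jac Y x0)) mulr_natl mulr2n lerD.
rewrite (@le_trans _ _ (m.+1%:R * (2 * e'))) //.
  by rewrite ler_pM // ler_nat.
rewrite /e'; have : m.+1%:R != 0 :> R by rewrite pnatr_eq0.
by move=> ?; rewrite le_eqVlt; apply/orP; left; apply/eqP; field.
Unshelve. all: by end_near. Qed.

(** The radius in [C1_strict] serves all base points near a given one, hence, by compactness of
    [0, 1], a whole arc. This bounds the linearization error along a trajectory at all times at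
    once. *)
Lemma C1_uniform_strict (R : realType) m n (U : set 'rV[R]_m) (Y : 'rV[R]_m -> 'rV[R]_n)
    (gamma : R -> 'rV[R]_m) :
  open U -> Ck 1 U Y ->
  (forall t : R, 0 <= t <= 1 -> U (gamma t) /\ {for t, continuous gamma}) ->
  forall e : R, 0 < e -> exists2 d : R, 0 < d &
    forall (t : R) (v : 'rV[R]_m), 0 <= t <= 1 -> `|v| < d ->
    `|Y (gamma t + v) - Y (gamma t) - v *m jac Y (gamma t)| <= e * `|v|.
Proof.
move=> oU C1Y Hg e e0.
pose P (d t : R) := forall v : 'rV[R]_m, `|v| < d ->
  `|Y (gamma t + v) - Y (gamma t) - v *m jac Y (gamma t)| <= e * `|v|.
have H : \forall d \near (0 : R)^'+, `[0, 1]%classic `<=` P d.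
  have /compact_near_coveringP := @segment_compact R 0 1; apply => t.
  rewrite /= in_itv => /Hg[Ut ct].
  have [r r0 Hr] := C1_strict oU C1Y Ut e0.
  have r2 : 0 < r / 2 by rewrite divr_gt0.
  have /cvgr_distC_lt/(_ _ r2) ct2 := ct.
  near=> t' d.
  have dr : d < r / 2 by near: d; exact: nbhs_right_lt.
  have gt' : `|gamma t' - gamma t| < r / 2 by near: t'; exact: ct2.
  rewrite /P /= => v vd; have vr := lt_trans vd dr.
  have := Hr (gamma t' + v) (gamma t') (gamma t').
  have -> : gamma t' + v - gamma t' = v by rewrite addrAC subrr add0r.
  apply; try by lra.
  by rewrite -addrA [v - _]addrC addrA (le_lt_trans (ler_normD _ _)) //; lra.
have [d [d0 Hd]] : exists d : R, 0 < d /\ `[0, 1]%classic `<=` P d.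
  have H2 : \forall d \near (0 : R)^'+, 0 < d /\ `[0, 1]%classic `<=` P d.
    by near=> d; split; near: d; [exact: nbhs_right_gt|exact: H].
  exact: (@filter_ex _ _ (at_right_proper_filter 0)) H2.
by exists d => // t v t01 vd; apply: Hd => //=; rewrite in_itv.
Unshelve. all: by end_near. Qed.

(* The quotients (f (x + h e_i) - f x) / h form a Cauchy family as h -> 0. *)
Lemma approx_linear_differentiable (R : realType) m n
    (f : 'rV[R]_m -> 'rV[R]_n) (x : 'rV[R]_m) (C : R) :
  (forall eta : R, 0 < eta -> exists2 d : R, 0 < d &
    forall k (c : 'I_k -> R) (u : 'I_k -> 'rV[R]_m), (forall i, `|u i| < d) ->
    `|\sum_i c i *: (f (x + u i) - f x)| <=
       C * `|\sum_i c i *: u i| + eta * \sum_i `|c i| * `|u i|) ->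
  differentiable f x.
Proof.
move=> H.
pose e_ (i : 'I_m) : 'rV[R]_m := delta_mx 0 i.
have ne i : `|e_ i| <= 1.
  by apply: mx_norm_le => // k l; rewrite mxE; case: (_ && _); rewrite ?normr1 ?normr0.
pose M (h : R) : 'M[R]_(m, n) := \matrix_i (h^-1 *: (f (x + h *: e_ i) - f x)).
have cauchyM eta : 0 < eta -> exists2 d : R, 0 < d &
    forall h h' : R, 0 < h < d -> 0 < h' < d -> `|M h - M h'| <= 2 * eta.
  move=> eta0; have [d d0 Hd] := H _ eta0; exists d => // h h' /andP[h0 hd] /andP[h'0 h'd].
  apply: mx_norm_le => [|i j]; first by rewrite mulr_ge0 // ltW.
  (* With these coefficients the combination of the increments vanishes, so only the eta term of [H]
     remains. *)
  pose c (k : 'I_2) : R := if k == 0 then h^-1 else - h'^-1.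
  pose u (k : 'I_2) := if k == 0 then h *: e_ i else h' *: e_ i.
  have ud k : `|u k| < d.
    rewrite /u; case: ifP => _; rewrite normrZ gtr0_norm //.
      by rewrite (le_lt_trans _ hd) // ler_piMr // ltW.
    by rewrite (le_lt_trans _ h'd) // ler_piMr // ltW.
  have := Hd _ c u ud; rewrite !big_ord_recl !big_ord0 /c /u /= !addr0 !scalerA.
  rewrite mulVf ?gt_eqF // mulNr mulVf ?gt_eqF // scaleN1r scale1r subrr normr0 mulr0 add0r.
  rewrite normrN !normrZ !normfV !mulrA !mulVf ?normr_eq0 ?gt_eqF // !mul1r.
  move=> /(le_trans (mx_entry_le _ 0 j)) {}Hd.
  have -> : (M h - M h') i j = (h^-1 *: (f (x + h *: e_ i) - f x) + - h'^-1 *: (f (x + h' *: e_ i) - f x)) 0 j.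
    by rewrite scaleNr !mxE.
  apply: (le_trans Hd); rewrite [2 * _]mulrC ler_wpM2l ?(ltW eta0) //.
  by have := ne i; lra.
have [L ML] : exists L : 'M[R]_(m, n), M h @[h --> (0 : R)^'+] --> L.
  suff : cvg (M h @[h --> (0 : R)^'+]) by move=> ?; exists (lim (M h @[h --> (0 : R)^'+])).
  apply/cauchy_cvgP/cauchy_exP => e e0.
  have e4 : 0 < e / 4 by rewrite divr_gt0.
  have [d d0 Hd] := cauchyM _ e4; exists (M (d / 2)).
  suff : \forall h \near (0 : R)^'+, ball (M (d / 2)) e (M h) by [].
  near=> h; rewrite mx_norm_ball /ball_ /=.
  rewrite (@le_lt_trans _ _ (2 * (e / 4))) //; last by lra.
  apply: Hd; first by apply/andP; split; lra.
  by apply/andP; split; near: h; [exact: nbhs_right_gt|exact: nbhs_right_lt].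
suff /differentiable_rVP[] : forall e : R, 0 < e ->
    \forall y \near x, `|f y - f x - (y - x) *m L| <= e * `|y - x| by [].
(* The total error is eta (1 + m) |u| for comparing the increment with [M h], plus eta m |u| for
   replacing [M h] by its limit. *)
move=> e e0; pose eta := e / (2 * m%:R + 1).
have m0 : 0 < 2 * m%:R + 1 :> R by rewrite ltr_wpDl // mulr_ge0.
have eta0 : 0 < eta by rewrite divr_gt0.
have [d d0 Hd] := H _ eta0.
near=> y; set u := y - x.
have ud : `|u| < d.
  by rewrite /u mx_distrC; near: y; apply: cvgr_dist_lt => //; exact: cvg_id.
have [h [/andP[h0 hd] hL]] : exists h, 0 < h < d /\ `|M h - L| <= eta.
  have : \forall h \near (0 : R)^'+, 0 < h < d /\ `|M h - L| <= eta.
    near=> h; split.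
      by apply/andP; split; near: h; [exact: nbhs_right_gt|exact: nbhs_right_lt].
    by rewrite mx_distrC; near: h; have /cvgrPdist_le/(_ _ eta0) := ML.
  by move=> /filter_ex.
have E : f y - f x - u *m L = (f y - f x - u *m M h) + u *m (M h - L).
  by rewrite mulmxBr addrA subrK.
rewrite {}E (le_trans (ler_normD _ _)) //.
have E1 : `|u *m (M h - L)| <= m%:R * eta * `|u|.
  by rewrite (le_trans (mulmx_norm_le _ _)) // ler_wpM2r // ler_wpM2l.
(* Again a vanishing combination: u minus its expansion in the vectors h e_i. *)
pose c (k : 'I_m.+1) : R := if unlift 0 k is Some i then - (u 0 i * h^-1) else 1.
pose w (k : 'I_m.+1) := if unlift 0 k is Some i then h *: e_ i else u.
have wd k : `|w k| < d.
  rewrite /w; case: (unlift 0 k) => [i|] //; rewrite normrZ gtr0_norm //.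
  by rewrite (le_lt_trans _ hd) // ler_piMr // ltW.
have := Hd _ c w wd; rewrite !big_ord_recl /c /w unlift_none.
under eq_bigr do rewrite liftK.
under [X in C * `|_ + X|]eq_bigr do rewrite liftK.
under [X in eta * (_ + X)]eq_bigr do rewrite liftK.
have -> : \sum_(i < m) - (u 0 i * h^-1) *: (f (x + h *: e_ i) - f x) = - (u *m M h).
  rewrite mulmx_sum_row -sumrN; apply: eq_bigr => i _.
  by rewrite rowK scalerA scaleNr.
have -> : \sum_(i < m) - (u 0 i * h^-1) *: (h *: e_ i) = - u.
  rewrite [in RHS](row_sum_delta u) -sumrN; apply: eq_bigr => i _.
  by rewrite scalerA mulNr divfK ?gt_eqF // scaleNr.
rewrite !scale1r subrr normr0 mulr0 add0r normr1 mul1r /u [x + _]addrC subrK -/u => E2.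
have E3 : \sum_(i < m) `|- (u 0 i * h^-1)| * `|h *: e_ i| <= m%:R * `|u|.
  rewrite (@le_trans _ _ (\sum_(i < m) `|u|)) //; last by rewrite sumr_const card_ord mulr_natl.
  apply: ler_sum => i _; rewrite normrN normrM normfV normrZ.
  rewrite -mulrA mulKf ?normr_eq0 ?gt_eqF //.
  by rewrite (le_trans _ (mx_entry_le u 0 i)) // ler_piMr.
have {E2 E3}E2 : `|f y - f x - u *m M h| <= eta * (`|u| + m%:R * `|u|).
  by rewrite (le_trans E2) // ler_wpM2l ?(ltW eta0) // lerD2l.
rewrite (le_trans (lerD E2 E1)) //.
have -> : eta * (`|u| + m%:R * `|u|) + m%:R * eta * `|u| = eta * (2 * m%:R + 1) * `|u| by ring.
by rewrite /eta divfK ?gt_eqF.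
Unshelve. all: by end_near. Qed.

Lemma approx_is_derive (R : realType) (V : normedModType R) (f : R -> V) (s : R) (v : V) :
  (forall e : R, 0 < e ->
    \forall y \near s, `|f y - f s - (y - s) *: v| <= e * `|y - s|) ->
  is_derive s 1 f v.
Proof.
have sv_lin : linear ( *:%R ^~ v : R -> V).
  by move=> u y z; rewrite scalerDl scalerA.
pose svM := GRing.isLinear.Build _ _ _ _ _ sv_lin.
pose svL : {linear R -> V} := HB.pack ( *:%R ^~ v : R -> V) svM.
move=> H; have [|df E] := @approx_differentiable R R V f s svL _ H.
  exact: scalel_continuous.
by apply: DeriveDef; [exact/derivable1_diffP|rewrite deriveE // E /= scale1r].
Qed.

Lemma jac_mulmxr (R : realType) m n (B : 'M[R]_(m, n)) x :
  differentiable (mulmxr B : 'rV[R]_m -> 'rV[R]_n) x /\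
  jac (mulmxr B : 'rV[R]_m -> 'rV[R]_n) x = B.
Proof.
apply/differentiable_rVP => e e0; near=> y.
by rewrite /= -mulmxBl subrr normr0 mulr_ge0 // ltW.
Unshelve. all: by end_near. Qed.

(* A fixed vector of L t can be chosen to be an eigenvector a + i b of A; then
   the entries of a L_s and b L_s satisfy (a_j^2 + b_j^2)' = 2 Re z (a_j^2 + b_j^2),
   which is incompatible with t-periodicity. *)
Lemma one_parameter_fixed (R : realType) n (L : R -> 'M[R]_n) (A : 'M[R]_n) (eps C : R) :
  0 < eps -> L 0 = 1%:M -> (forall s r, L (s + r) = L s *m L r) ->
  (forall (s : R) (v : 'rV[R]_n), `|s| <= eps ->
     `|v *m L s - v - s *: (v *m A)| <= C * `|s| ^+ 2 * `|v *m A|) ->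
  (forall z : R[i], eigenvalue (map_mx (real_complex R) A) z -> complex.Re z != 0) ->
  forall (t : R) (v : 'rV[R]_n), t != 0 -> v *m L t = v -> v = 0.
Proof.
move=> eps0 L0 LD Lexp hyp t v tn0 vL.
(* By [LD], w L_y = (w L_s) L_(y-s), and the quadratic error in [Lexp] at time y - s is o(|y -
   s|). *)
have D (w : 'rV[R]_n) (s : R) : is_derive s 1 (fun s => w *m L s) (w *m L s *m A).
  set u := w *m L s.
  apply: approx_is_derive => e e0; pose k := `|C| * `|u *m A| + 1.
  have k0 : 0 < k by rewrite ltr_wpDl // mulr_ge0.
  pose d := Num.min eps (e / k); have d0 : 0 < d by rewrite lt_min eps0 divr_gt0.
  near=> y; have : `|y - s| < d by rewrite distrC; near: y; apply: cvgr_dist_lt => //; exact: cvg_id.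
  rewrite lt_min => /andP[/ltW yeps ye].
  have -> : w *m L y = u *m L (y - s) by rewrite /u -mulmxA -LD [s + _]addrC subrK.
  rewrite (le_trans (Lexp _ _ yeps)) // expr2 mulrA mulrAC.
  rewrite ler_wpM2r // mulrAC.
  rewrite (@le_trans _ _ (k * `|y - s|)) //.
    rewrite ler_wpM2r // /k; have := ler_wpM2r (normr_ge0 (u *m A)) (ler_norm C); lra.
  by move: ye; rewrite ltr_pdivlMr // mulrC => /ltW.
(* Both sides come from the derivative at r = 0 of w L_(s+r), written once as (w L_s) L_r and once
   as (w L_r) L_s. *)
have LA s : L s *m A = A *m L s.
  apply/row_matrixP => i; rewrite !rowE; set w := delta_mx _ _.
  have D1 := D (w *m L s) 0; rewrite L0 mulmx1 in D1.
  have [dm jm] := jac_mulmxr (L s) (w *m L 0).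
  have := is_derive_comp_rV (D w 0) dm; rewrite jm L0 mulmx1 => D2.
  have Ef : mulmxr (L s) \o (fun r => w *m L r) = (fun r => w *m L s *m L r).
    by apply/funext => r /=; rewrite -!mulmxA -!LD addrC.
  rewrite Ef in D2; rewrite !mulmxA.
  by case: D1 => _ <-; case: D2 => _ <-.
apply/eqP/negPn/negP => v0.
pose rc := real_complex R.
pose W := kermx (map_mx rc (L t - 1%:M)).
have W0 : W != 0.
  rewrite /W -map_kermx map_mx_eq0; apply: contra v0 => /eqP K0.
  by rewrite -submx0 -K0; apply/sub_kermxP; rewrite mulmxBr vL mulmx1 subrr.
have sW : stablemx W (map_mx rc A).
  apply: comm_mx_stable_ker; rewrite /comm_mx -!map_mxM; congr map_mx.
  by rewrite mulmxBr mulmxBl mulmx1 mul1mx LA.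
have [z [w [w0 /sub_kermxP wL wA]]] := stable_eigenvector W0 sW.
have zr : complex.Re z != 0 by apply: hyp; apply/eigenvalueP; exists w.
have [aA bA] := eigenvector_ReIm wA.
have wL' : w *m map_mx rc (L t - 1%:M) = 0 *: w by rewrite wL scale0r.
have [] := eigenvector_ReIm wL'.
move: aA bA; set a := map_mx _ _; set b := map_mx _ _.
set al := complex.Re z in zr *; set be := complex.Im z => aA bA.
rewrite /= !scale0r subr0 addr0 !mulmxBr !mulmx1 => /eqP + /eqP.
rewrite !subr_eq0 => /eqP aL /eqP bL.
have [j wj] : exists j, w 0 j != 0.
  by apply/existsP; apply: contraNT w0 => /existsPn H; apply/eqP/rowP => j; rewrite mxE; apply/eqP/negPn.
pose ua (s : R) : R := (a *m L s) 0 j; pose ub (s : R) : R := (b *m L s) 0 j.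
have Da (s : R) : is_derive s 1 ua (al * ua s - be * ub s).
  have := is_derive_entry 0 j (D a s); rewrite -mulmxA LA mulmxA aA mulmxBl -!scalemxAl.
  by rewrite mxDE mxNE !mxZE.
have Db (s : R) : is_derive s 1 ub (be * ua s + al * ub s).
  have := is_derive_entry 0 j (D b s); rewrite -mulmxA LA mulmxA bA mulmxDl -!scalemxAl.
  by rewrite mxDE !mxZE.
pose rho : R -> R := (ua * ua + ub * ub) * (expR \o *%R (- 2 * al)).
have Drho (s : R) : is_derive s 1 rho 0.
  have Dl : is_derive s 1 ( *%R (- 2 * al)) (- 2 * al).
    have := @is_deriveM R R (cst (- 2 * al)) id s 1 0 1 _ _.
    rewrite /cst /= scaler0 addr0 [_ *: 1]mulr1; apply.
  have De : is_derive s 1 (expR \o *%R (- 2 * al)) ((- 2 * al) *: expR (- 2 * al * s)).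
    by rewrite [_ *: _]mulrC; exact: is_derive1_comp (is_derive_expR _) Dl.
  have := is_deriveM (is_deriveD (is_deriveM (Da s) (Da s)) (is_deriveM (Db s) (Db s))) De.
  by move=> /is_derive_eq; apply; rewrite /= !fctE /GRing.scale /=; ring.
have E : rho 0 = rho t by exact: is_derive_0_is_cst.
move: E; rewrite /rho !fctE /= mulr0 expR0 /ua /ub L0 !mulmx1 aL bL mulr1.
have ab0 : a 0 j * a 0 j + b 0 j * b 0 j != 0.
  apply: contra wj => H; rewrite eq_complex; move: H.
  by rewrite -!expr2 paddr_eq0 ?sqr_ge0 // !expf_eq0 /= /a /b !mxE.
move/eqP; rewrite -{1}[_ + _]mulr1 (inj_eq (mulfI ab0)) => /eqP E.
have /expR_inj/eqP : expR (- 2 * al * t) = expR 0 by rewrite expR0.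
by rewrite !mulf_eq0 oppr_eq0 pnatr_eq0 /= (negPf zr) (negPf tn0).
Unshelve. all: by end_near. Qed.

(** * Flow boxes *)

Section Charts.
Context {R : realType} {n : nat} {M : topologicalType}.
Implicit Type c : chart R n M.

Lemma chart_invP c x : (chart_map c @` chart_dom c) x ->
  chart_dom c (chart_inv c x) /\ chart_map c (chart_inv c x) = x.
Proof. by move=> [q dq <-]; rewrite chart_mapK. Qed.

Lemma chart_ball_nbhs c q (x0 : 'rV[R]_n) (r : R) :
  chart_dom c q -> `|chart_map c q - x0| < r ->
  \forall q' \near q, chart_dom c q' /\ `|chart_map c q' - x0| < r.
Proof.
move=> dq qr; 
have e0 : 0 < r - `|chart_map c q - x0| by rewrite subr_gt0.
have /cvgr_dist_lt/(_ _ e0) H := chart_map_cont dq.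
near=> q'; split.
  by near: q'; apply: open_nbhs_nbhs; split => //; exact: chart_dom_open.
have -> : chart_map c q' - x0 = (chart_map c q' - chart_map c q) + (chart_map c q - x0).
  by rewrite addrA subrK.
rewrite (le_lt_trans (ler_normD _ _)) // -ltrBrDr mx_distrC.
by near: q'; exact: H.
Unshelve. all: by end_near. Qed.

(** A compact image in a Hausdorff space. This prevents a curve from leaving the chart domain while
    its coordinates still converge inside the ball. *)
Lemma closed_ball_inv_closed c (x0 : 'rV[R]_n) (r : R) : hausdorff_space M ->
  (forall x, `|x - x0| <= r -> (chart_map c @` chart_dom c) x) ->
  closed (chart_inv c @` [set x | `|x - x0| <= r]).
Proof.
move=> hM sub; apply: compact_closed => //; apply: continuous_compact.
  apply: continuous_in_subspaceT => x; rewrite inE /= => xr.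
  by apply: chart_inv_cont; exact: sub.
apply: bounded_closed_compact.
  exists (r + `|x0|); split => [|C rC x /= xr]; first exact: num_real.
  by rewrite -(subrK x0 x) (le_trans (ler_normD _ _)) // (le_trans _ (ltW rC)) // lerD2r.
pose f (x : 'rV[R]_n) : R := `|x - x0|.
have cf : continuous f.
  move=> x; apply: (@continuous_comp _ _ _ (fun x : 'rV[R]_n => x - x0) (fun x => `|x|)); last exact: norm_continuous.
  by apply: continuousB; [exact: cvg_id|exact: cst_continuous].
have -> : [set x | `|x - x0| <= r] = f @^-1` [set t | t <= r] by [].
by apply: closed_comp; [move=> x _; exact: cf|exact: closed_le].
Qed.

(* At the first exit time from the open ball of radius 2 rho the curve would
   be in a closed, strictly smaller ball, whose image in M is closed. *)
Lemma curve_stays c (gamma : R -> M) (Z : M -> 'rV[R]_n) (x0 : 'rV[R]_n) (rho : R) :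
  hausdorff_space M -> continuous gamma ->
  (forall t : R, chart_dom c (gamma t) ->
     is_derive t 1 (chart_map c \o gamma) (Z (gamma t))) ->
  (forall x, `|x - x0| < 2 * rho -> (chart_map c @` chart_dom c) x) ->
  (forall q, chart_dom c q -> `|chart_map c q - x0| < 2 * rho -> `|Z q| <= rho) ->
  chart_dom c (gamma 0) -> `|chart_map c (gamma 0) - x0| < rho ->
  forall t : R, 0 <= t <= 1 ->
    chart_dom c (gamma t) /\ `|chart_map c (gamma t) - x0| < 2 * rho.
Proof.
move=> hM cg dg sub Zr d0 g0 t t01; apply: contrapT => nt.
pose D q := chart_dom c q /\ `|chart_map c q - x0| < 2 * rho.
have r0 : 0 < rho by rewrite (le_lt_trans _ g0).
pose S := [set t | 0 <= t <= 1 /\ ~ D (gamma t)].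
have S0 : S !=set0 by exists t.
have lS : has_lbound S by exists 0 => s [/andP[]].
have hS : has_inf S by [].
pose u := inf S.
have u0 : 0 <= u by apply: lb_le_inf => // s [/andP[]].
have u1 : u <= 1 by apply: (le_trans (ge_inf lS (conj t01 nt : S t))); case/andP: t01.
have below s : 0 <= s < u -> D (gamma s).
  move=> /andP[s0 su]; apply: contrapT => Ds.
  have /(ge_inf lS) : S s by split=> //; rewrite s0 (le_trans (ltW su)).
  by rewrite leNgt su.
have Du : D (gamma u).
  have [->|un0] := eqVneq u 0; first by split=> //; lra.
  have ugt0 : 0 < u by rewrite lt0r un0.
  (* At speed at most rho during a time u <= 1, the curve moves by at most rho u from a point at
     distance less than rho. *)
  pose r1 := `|chart_map c (gamma 0) - x0| + rho * u.
  have r12 : r1 < 2 * rho.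
    have : rho * u <= rho by rewrite ler_piMr // ltW.
    by rewrite /r1; lra.
  have sub1 x : `|x - x0| <= r1 -> (chart_map c @` chart_dom c) x.
    by move=> xr; apply: sub; exact: le_lt_trans r12.
  suff [x xr xg] : (chart_inv c @` [set x | `|x - x0| <= r1]) (gamma u).
    have [dx cx] := chart_invP (sub1 x xr).
    by rewrite -xg /D cx; split=> //; exact: le_lt_trans r12.
  apply: (closed_ball_inv_closed hM sub1) => V nV.
  have Hn : \forall s \near u^'-, V (gamma s) /\ 0 <= s < u.
    near=> s; split; first by near: s; exact: (cvg_at_left_filter (cg u)).
    by apply/andP; split; [apply: ltW|]; near: s; [exact: nbhs_left_gt|exact: nbhs_left_lt].
  have [s Hs] : exists s, V (gamma s) /\ 0 <= s < u .
    by apply: (@filter_ex _ _ (at_left_proper_filter u)) Hn.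
  case: Hs => Vs /andP[s0 su].
  have [ds sr] : D (gamma s) by apply: below; rewrite s0.
  exists (gamma s); split=> //; exists (chart_map c (gamma s)); last exact: chart_mapK.
  have Ds x : 0 <= x <= s -> D (gamma x).
    by move=> /andP[x0' xs]; apply: below; rewrite x0' (le_lt_trans xs).
  have := @mean_value_ineq _ _ (chart_map c \o gamma) (Z \o gamma) 0 s rho s0.
  move=> /(_ _ _)/= H; rewrite /= /r1 -(subrK (chart_map c (gamma 0)) (chart_map c (gamma s))).
  rewrite -addrA (le_trans (ler_normD _ _)) // [leLHS]addrC lerD2l.
  rewrite (@le_trans _ _ (rho * (s - 0))) //.
    by apply: H => x /Ds[? ?]; [exact: dg|exact: Zr].
  by rewrite subr0 ler_wpM2l ?(ltW r0) // ltW.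
have /(cg u) : nbhs (gamma u) D by case: Du => ? ?; exact: chart_ball_nbhs.
move=> /nbhs_ballP[d /= d0' Hd].
have [s [s01 Ds] su] := inf_adherent d0' hS.
have us : u <= s by apply: ge_inf.
apply: Ds; apply: Hd; rewrite /ball /= ltr_distlC.
by move: su; rewrite -/u => su; apply/andP; split; lra.
Unshelve. all: by end_near. Qed.

End Charts.

Section FlowBox.
Context {R : realType} {n : nat} {M : topologicalType} {A : set (chart R n M)}.
Context {X : chart R n M -> M -> 'rV[R]_n} {Phi : R -> M -> M}.
Hypothesis M_manifold : smooth_manifold A.
Hypothesis X_C1 : C1_vector_field A X.
Hypothesis Phi_flow : flow_of A X Phi.

Definition local_field (c : chart R n M) : 'rV[R]_n -> 'rV[R]_n := X c \o chart_inv c.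

(** Short trajectories from the ball of radius rho stay in the ball of radius 2 rho, where K
    controls the field; K eps <= 1/2 is what [short_gronwall] requires once time is rescaled to
    [0, 1]. *)
Record flow_box (c : chart R n M) (x0 : 'rV[R]_n) (rho eps K : R) : Prop := FlowBox {
  box_rho : 0 < rho;
  box_eps : 0 < eps;
  box_K : 0 <= K;
  box_Keps : K * eps <= 2^-1;
  box_sub : forall x : 'rV[R]_n, `|x - x0| < 2 * rho -> (chart_map c @` chart_dom c) x;
  box_lip : forall a b : 'rV[R]_n, `|a - x0| < 2 * rho -> `|b - x0| < 2 * rho ->
    `|local_field c a - local_field c b| <= K * `|a - b|;
  box_jac : forall a v : 'rV[R]_n, `|a - x0| < 2 * rho -> `|v *m jac (local_field c) a| <= K * `|v|;
  box_stay : forall q (s : R), chart_dom c q -> `|chart_map c q - x0| < rho -> `|s| <= eps ->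
    chart_dom c (Phi s q) /\ `|chart_map c (Phi s q) - x0| < 2 * rho }.

(* Rescaling time to [0, 1] treats positive and negative s at once. *)
Lemma scaled_curve_derive c q (s t : R) : A c -> chart_dom c (Phi (t * s) q) ->
  is_derive t 1 (fun t => chart_map c (Phi (t * s) q))
    (s *: local_field c (chart_map c (Phi (t * s) q))).
Proof.
move=> Ac dc; rewrite /local_field /= chart_mapK //.
have [_ /(_ c (t * s) Ac dc)[d1 d2]] := flow_integral Phi_flow q.
have d1' : differentiable (chart_map c \o Phi^~ q) (t * s) by apply/derivable1_diffP.
have ds : is_derive t 1 (fun t : R => t * s) s by exact: (@is_derive_scalel R R t s).
have ds' : differentiable (fun t : R => t * s) t by apply/derivable1_diffP; case: ds.
have E : (fun t => chart_map c (Phi (t * s) q)) = (chart_map c \o Phi^~ q) \o (fun t => t * s) by [].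
rewrite E; have dd := differentiable_comp ds' d1'.
apply: DeriveDef; first exact/derivable1_diffP.
rewrite (deriveE _ dd) (diff_comp ds' d1') /= -(deriveE _ ds') derive_val.
by rewrite -d2 (deriveE _ d1') -linearZ /= [s *: 1]mulr1.
Qed.

Lemma scaled_curve_continuous q (s : R) : continuous (fun t : R => Phi (t * s) q).
Proof.
move=> t; apply: (@continuous_comp _ _ _ (fun t : R => t * s) (Phi^~ q)).
  by apply: continuousM; [exact: cvg_id|exact: cst_continuous].
by case: (flow_integral Phi_flow q) => + _; apply.
Qed.

Lemma flow_box_exists c p : A c -> chart_dom c p ->
  exists rho eps K, flow_box c (chart_map c p) rho eps K.
Proof.
move=> Ac dp; set x0 := chart_map c p.
have Ux0 : (chart_map c @` chart_dom c) x0 by exists p.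
have oU := @chart_img_open R n M c; have C1Y := field_C1 X_C1 Ac.
have [r1 r10 Hr1] := C1_strict oU C1Y Ux0 (@ltr01 R).
have : \forall x \near x0, (chart_map c @` chart_dom c) x /\
    `|jac (local_field c) x - jac (local_field c) x0| <= 1.
  near=> x; split; near: x; [exact: open_nbhs_nbhs|exact: (C1_jac_near C1Y)].
move=> /nbhs_normP[r2 /= r20 Hr2].
pose r := Num.min r1 r2; have r0 : 0 < r by rewrite lt_min r10.
(* The second summand bounds the Jacobian on the ball; the extra 1 is the error allowed in [Hr1], so
   that K is also a Lipschitz constant. *)
pose K := 1 + n%:R * (`|jac (local_field c) x0| + 1).
have K0 : 0 < K by rewrite ltr_pwDl // mulr_ge0 // addr_ge0.
have rr1 (x : 'rV[R]_n) : `|x - x0| < r -> `|x - x0| < r1 by rewrite lt_min => /andP[].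
have rr2 (x : 'rV[R]_n) : `|x - x0| < r -> (chart_map c @` chart_dom c) x /\
    `|jac (local_field c) x - jac (local_field c) x0| <= 1.
  by rewrite lt_min => /andP[_ xr]; apply: Hr2; rewrite /= mx_distrC.
have jK (x v : 'rV[R]_n) : `|x - x0| < r -> `|v *m jac (local_field c) x| <= (K - 1) * `|v|.
  move=> /rr2[_ H]; rewrite (le_trans (mulmx_norm_le _ _)) // ler_wpM2r //.
  rewrite /K addrC addKr ler_wpM2l // -(subrK (jac (local_field c) x0) (jac (local_field c) x)).
  by rewrite (le_trans (ler_normD _ _)) // addrC lerD2l.
have lip (a b : 'rV[R]_n) : `|a - x0| < r -> `|b - x0| < r ->
    `|local_field c a - local_field c b| <= K * `|a - b|.
  move=> ar br; have := Hr1 a b b (rr1 _ ar) (rr1 _ br) (rr1 _ br).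
  have /= := jK b (a - b) br; set w := _ *m _ => Hw; rewrite mul1r => H.
  rewrite -(subrK w (local_field c a - local_field c b)) (le_trans (ler_normD _ _)) //.
  by rewrite (le_trans (lerD H Hw)) // mulrBl mul1r addrC subrK.
pose rho := r / 2; have rho0 : 0 < rho by rewrite divr_gt0.
have rhoE : 2 * rho = r by rewrite /rho mulrC divfK.
pose m := `|local_field c x0| + K * r.
have m0 : 0 <= m by rewrite addr_ge0 // mulr_ge0 // ltW.
have Ym (x : 'rV[R]_n) : `|x - x0| < r -> `|local_field c x| <= m.
  move=> xr; rewrite -(subrK (local_field c x0) (local_field c x)) (le_trans (ler_normD _ _)) //.
  rewrite addrC lerD2l (le_trans (lip _ _ xr _)) ?subrr ?normr0 //.
  by rewrite ler_wpM2l ?(ltW K0) // ltW.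
(* The first bound keeps the displacement below rho, m being a bound for the speed; the second gives
   K eps <= 1/2. *)
pose eps := Num.min (rho / (m + 1)) (2^-1 / K).
have m1 : 0 < m + 1 by rewrite ltr_wpDl.
exists rho, eps, K; split; rewrite ?rhoE //.
- by rewrite lt_min !divr_gt0.
- exact: ltW.
- rewrite mulrC -ler_pdivlMr // /eps.
  by rewrite ge_min lexx orbT.
- by move=> x /rr2[].
- move=> a v ar; rewrite (le_trans (jK _ _ ar)) // ler_wpM2r //.
  by rewrite gerBl.
- move=> q s dq qr sE.
  have smr : `|s| * m <= rho.
    have : `|s| <= rho / (m + 1) by rewrite (le_trans sE) // ge_min lexx.
    rewrite ler_pdivlMr // => H; apply: le_trans H.
    by rewrite ler_wpM2l // lerDl.
  have /= := @curve_stays _ _ _ c (fun t => Phi (t * s) q) (fun q => s *: X c q) x0 rho.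
  rewrite mul0r (flow0 Phi_flow) rhoE => H.
  have := H (manifold_hausdorff M_manifold) (@scaled_curve_continuous q s) _ _ _ dq qr 1 _.
  rewrite mul1r; apply; rewrite ?ler01 ?lexx //.
  + move=> t dt; have := scaled_curve_derive Ac dt.
    by rewrite /local_field /= chart_mapK.
  + by move=> x /rr2[].
  + move=> q' dq' /Ym; rewrite /local_field /= chart_mapK // normrZ => Hm.
    by rewrite (le_trans _ smr) // ler_wpM2l.
Unshelve. all: by end_near. Qed.

(** * Gronwall-type estimates inside a flow box *)

Section Estimates.
Context {c : chart R n M} {x0 : 'rV[R]_n} {rho eps K : R}.
Hypothesis Ac : A c.
Hypothesis box : flow_box c x0 rho eps K.
Let Y := local_field c.

Lemma box_scaled q (s t : R) : chart_dom c q -> `|chart_map c q - x0| < rho -> `|s| <= eps ->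
  0 <= t <= 1 ->
  [/\ chart_dom c (Phi (t * s) q), `|chart_map c (Phi (t * s) q) - x0| < 2 * rho &
    is_derive t 1 (fun t => chart_map c (Phi (t * s) q))
      (s *: Y (chart_map c (Phi (t * s) q)))].
Proof.
move=> dq qr sE /andP[t0 t1].
have [d1 d2] : chart_dom c (Phi (t * s) q) /\ `|chart_map c (Phi (t * s) q) - x0| < 2 * rho.
  apply: (box_stay box) => //; rewrite normrM ger0_norm // (le_trans _ sE) //.
  by rewrite ler_piMl.
by split=> //; exact: scaled_curve_derive.
Qed.

Lemma box_sK (s : R) : `|s| <= eps -> 0 <= `|s| * K <= 2^-1.
Proof.
move=> sE; rewrite mulr_ge0 ?(box_K box) //= mulrC (le_trans _ (box_Keps box)) //.
by rewrite ler_wpM2l // (box_K box).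
Qed.

Lemma box_rho_lt q : `|chart_map c q - x0| < rho -> `|chart_map c q - x0| < 2 * rho.
Proof. by have := box_rho box; lra. Qed.

Lemma flow_lipschitz q q' (s t : R) : chart_dom c q -> chart_dom c q' ->
  `|chart_map c q - x0| < rho -> `|chart_map c q' - x0| < rho -> `|s| <= eps ->
  0 <= t <= 1 ->
  `|chart_map c (Phi (t * s) q) - chart_map c (Phi (t * s) q')| <=
     2 * `|chart_map c q - chart_map c q'|.
Proof.
move=> dq dq' qr qr' sE; move: t.
have := @short_gronwall R n
  (fun t => chart_map c (Phi (t * s) q) - chart_map c (Phi (t * s) q'))
  (fun t => s *: Y (chart_map c (Phi (t * s) q)) - s *: Y (chart_map c (Phi (t * s) q')))
  (`|s| * K) 0 (box_sK sE) (lexx 0).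
rewrite mul0r !(flow0 Phi_flow) addr0; apply=> t t01;
  have [_ r1 D1] := box_scaled dq qr sE t01; have [_ r2 D2] := box_scaled dq' qr' sE t01.
  exact: is_deriveB.
by rewrite -scalerBr normrZ addr0 -mulrA ler_wpM2l // (box_lip box).
Qed.

(** The displacement g satisfies |g'| <= |s| (K |g| + |Y(q)|), and [short_gronwall] applies. The
    bound is proportional to the initial speed, so that a point of zero velocity does not move. *)
Lemma flow_speed q (s t : R) : chart_dom c q -> `|chart_map c q - x0| < rho -> `|s| <= eps ->
  0 <= t <= 1 ->
  `|chart_map c (Phi (t * s) q) - chart_map c q| <= 2 * `|s| * `|Y (chart_map c q)|.
Proof.
move=> dq qr sE; move: t.
have := @short_gronwall R n
  (fun t => chart_map c (Phi (t * s) q) - chart_map c q)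
  (fun t => s *: Y (chart_map c (Phi (t * s) q)) - 0)
  (`|s| * K) (`|s| * `|Y (chart_map c q)|) (box_sK sE).
rewrite mul0r !(flow0 Phi_flow) subrr normr0 add0r -mulrA; apply; first by rewrite mulr_ge0.
  move=> t t01; have [_ _ D] := box_scaled dq qr sE t01.
  exact: is_deriveB.
move=> t t01; have [_ r1 _] := box_scaled dq qr sE t01.
rewrite subr0 normrZ -mulrA -mulrDr ler_wpM2l //.
rewrite -[X in `|X|](subrK (Y (chart_map c q))) (le_trans (ler_normD _ _)) // lerD2r.
by apply: (box_lip box) => //; exact: box_rho_lt.
Qed.

(** The velocity varies by at most K times the displacement, which [flow_speed] bounds. Keeping the
    factor |Y(q)| lets the same estimate serve at singularities and at regular points. *)
Lemma flow_expansion q (s : R) : chart_dom c q -> `|chart_map c q - x0| < rho -> `|s| <= eps ->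
  `|chart_map c (Phi s q) - chart_map c q - s *: Y (chart_map c q)| <=
     2 * K * `|s| ^+ 2 * `|Y (chart_map c q)|.
Proof.
move=> dq qr sE.
have := @mean_value_ineq R n
  (fun t => chart_map c (Phi (t * s) q) - t *: (s *: Y (chart_map c q)))
  (fun t => s *: Y (chart_map c (Phi (t * s) q)) - s *: Y (chart_map c q)) 0 1
  (2 * K * `|s| ^+ 2 * `|Y (chart_map c q)|) ler01.
rewrite mul0r mul1r scale0r subr0 scale1r (flow0 Phi_flow) subr0 mulr1 addrAC; apply=> t t01;
  have [_ r1 D1] := box_scaled dq qr sE t01.
  by apply: is_deriveB => //; exact: is_derive_scalel.
rewrite -scalerBr normrZ.
have H := box_lip box r1 (box_rho_lt qr).
rewrite (le_trans (ler_wpM2l (normr_ge0 s) H)) //.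
have := ler_wpM2l (box_K box) (flow_speed dq qr sE t01).
move=> /(ler_wpM2l (normr_ge0 s)) /le_trans; apply.
by rewrite le_eqVlt; apply/orP; left; apply/eqP; ring.
Qed.

(* Up to o(|u|), a linear combination of differences of trajectories solves the
   linearized equation along the trajectory of q, so it is controlled by its
   initial value; approx_linear_differentiable then applies. *)
Lemma flow_box_differentiable q (s : R) :
  chart_dom c q -> `|chart_map c q - x0| < rho -> `|s| <= eps ->
  differentiable (chart_map c \o Phi s \o chart_inv c) (chart_map c q).
Proof.
move=> dq qr sE; set x := chart_map c q.
apply: (@approx_linear_differentiable _ _ _ _ _ 2) => eta eta0.
pose gamma (t : R) := chart_map c (Phi (t * s) q).
have s1 : 0 < 4 * (`|s| + 1) by rewrite mulr_gt0 // ltr_wpDl.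
(* The error term r enters the final bound with a factor 2, for a total of 4 |s| e times the sum. *)
have [e e0 eE] : exists2 e : R, 0 < e & 4 * `|s| * e <= eta.
  exists (eta / (4 * (`|s| + 1))); first by rewrite divr_gt0.
  by rewrite mulrA ler_pdivrMr // [leLHS]mulrC ler_wpM2l ?(ltW eta0) // ler_wpM2l // lerDl.
have Hg (t : R) : 0 <= t <= 1 ->
    (chart_map c @` chart_dom c) (gamma t) /\ {for t, continuous gamma}.
  move=> t01; have [d1 _ D1] := box_scaled dq qr sE t01; split; first by exists (Phi (t * s) q).
  exact: is_derive_continuous D1.
have [d d0 Hd] := C1_uniform_strict (@chart_img_open R n M c) (field_C1 X_C1 Ac) Hg e0.
(* Trajectories separate by at most the factor 2, so d / 2 keeps all differences below d; the other
   bound keeps the starting points in the box. *)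
pose d' := Num.min (d / 2) (rho - `|x - x0|).
exists d'; first by rewrite lt_min divr_gt0 //= subr_gt0.
move=> k a u ud.
have ud1 i : `|u i| < d / 2 by have := ud i; rewrite lt_min => /andP[].
have ur i : `|x + u i - x0| < rho.
  have := ud i; rewrite lt_min => /andP[_ H].
  by rewrite addrAC (le_lt_trans (ler_normD _ _)) // -ltrBrDl.
pose y i := chart_inv c (x + u i).
have y_in i : chart_dom c (y i) /\ chart_map c (y i) = x + u i.
  by apply: chart_invP; apply: (box_sub box); have := ur i; have := box_rho box; lra.
have dy i : chart_dom c (y i) by case: (y_in i).
have yr i : `|chart_map c (y i) - x0| < rho by rewrite (y_in i).2.
pose D i (t : R) := chart_map c (Phi (t * s) (y i)) - gamma t.
pose D' i (t : R) := s *: Y (chart_map c (Phi (t * s) (y i))) - s *: Y (gamma t).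
have DD i (t : R) : 0 <= t <= 1 -> is_derive t 1 (D i) (D' i t).
  move=> t01; have [_ _ D1] := box_scaled dq qr sE t01.
  by have [_ _ D2] := box_scaled (dy i) (yr i) sE t01; exact: is_deriveB.
have Du i (t : R) : 0 <= t <= 1 -> `|D i t| <= 2 * `|u i|.
  move=> t01; rewrite /D /gamma (le_trans (flow_lipschitz (dy i) dq (yr i) qr sE t01)) //.
  by rewrite (y_in i).2 [x + _]addrC addrK.
pose r := 2 * `|s| * e * \sum_i `|a i| * `|u i|.
have sum0 : 0 <= \sum_i `|a i| * `|u i| by apply: sumr_ge0 => i _; exact: mulr_ge0.
have r0 : 0 <= r by rewrite !mulr_ge0 // ltW.
have := @short_gronwall R n (\sum_i (a i \*: D i)) (fun t => \sum_i (a i *: D' i t))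
  (`|s| * K) r (box_sK sE) r0.
move=> /(_ _ _ 1); rewrite ler01 lexx /= => G.
have sumE t : (\sum_i (a i \*: D i)) t = \sum_i (a i *: D i t) by rewrite fct_sumE.
have : `|\sum_i (a i *: D i 1)| <= 2 * (`|\sum_i (a i *: D i 0)| + r).
  rewrite -!sumE; apply: G => // t t01.
    by apply: is_derive_sum => i; apply: is_deriveZ; exact: DD.
  have [_ gr _] := box_scaled dq qr sE t01.
  pose J := jac (local_field c) (gamma t).
  rewrite sumE.
  have -> : \sum_i (a i *: D' i t) = s *: ((\sum_i (a i *: D i t)) *m J)
      + s *: \sum_i (a i *: (Y (gamma t + D i t) - Y (gamma t) - D i t *m J)).
    rewrite -scalerDr mulmx_suml -big_split /= scaler_sumr; apply: eq_bigr => i _.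
    rewrite -scalemxAl -scalerDr addrC subrK /D' -scalerBr scalerA [s * _]mulrC -scalerA.
    by rewrite /D [gamma t + _]addrC subrK.
  rewrite (le_trans (ler_normD _ _)) // lerD //.
    by rewrite normrZ -mulrA ler_wpM2l // (box_jac box).
  rewrite normrZ /r [2 * _]mulrC -!mulrA ler_wpM2l //.
  rewrite (le_trans (ler_norm_sum _ _ _)) // !mulr_sumr; apply: ler_sum => i _.
  have -> : 2 * (e * (`|a i| * `|u i|)) = `|a i| * (e * (2 * `|u i|)) by ring.
  rewrite normrZ ler_wpM2l //.
  have Dd : `|D i t| < d.
    by rewrite (le_lt_trans (Du i t t01)) //; have := ud1 i; lra.
  by rewrite (le_trans (Hd t (D i t) t01 Dd)) // ler_wpM2l ?(ltW e0) // Du.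
have E0 : \sum_i (a i *: D i 0) = \sum_i a i *: u i.
  apply: eq_bigr => i _; congr (_ *: _); rewrite /D /gamma mul0r !(flow0 Phi_flow).
  by rewrite (y_in i).2 [x + _]addrC addrK.
have E1 : \sum_i (a i *: D i 1) = \sum_i a i *: ((chart_map c \o Phi s \o chart_inv c) (x + u i) -
    (chart_map c \o Phi s \o chart_inv c) x).
  apply: eq_bigr => i _; congr (_ *: _); rewrite /D /gamma mul1r /=.
  by rewrite /x chart_mapK.
rewrite E0 E1 => /le_trans; apply; rewrite mulrDr lerD2l /r !mulrA.
have -> : 2 * 2 * `|s| * e = 4 * `|s| * e by ring.
by rewrite ler_wpM2r.
Qed.

Lemma flow_box_speed_bound q (s : R) : chart_dom c q -> `|chart_map c q - x0| < rho ->
  `|s| <= eps ->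
  `|chart_map c (Phi s q) - chart_map c q| <= 2 * `|s| * (`|Y x0| + 2 * K * rho).
Proof.
move=> dq qr sE; have := @flow_speed q s 1 dq qr sE; rewrite mul1r ler01 lexx => /(_ isT).
move=> /le_trans; apply; rewrite ler_wpM2l ?mulr_ge0 //.
rewrite -(subrK (Y x0) (Y (chart_map c q))) (le_trans (ler_normD _ _)) // [leLHS]addrC lerD2l.
have rho0 := box_rho box; have K0 := box_K box.
rewrite (le_trans (box_lip box (box_rho_lt qr) _)) ?subrr ?normr0 ?mulr_gt0 //.
by rewrite [2 * K]mulrC -mulrA ler_wpM2l //; lra.
Qed.

End Estimates.

(** * Differentiability of the flow *)

Definition coord (c c' : chart R n M) (h : M -> M) : 'rV[R]_n -> 'rV[R]_n :=
  chart_map c' \o h \o chart_inv c.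

(** Continuity is a separate clause because [chart_map c'] is meaningless outside its domain:
    differentiability of [coord c c' h] does not by itself keep h q in that domain for q near p. *)
Definition mdiff (h : M -> M) (p : M) : Prop :=
  {for p, continuous h} /\
  exists c c', [/\ A c, A c', chart_dom c p, chart_dom c' (h p) &
    differentiable (coord c c' h) (chart_map c p)].

Lemma chart_inv_near (c : chart R n M) p (P : set M) : chart_dom c p -> (\forall q \near p, P q) ->
  \forall x \near chart_map c p, P (chart_inv c x).
Proof.
move=> dp nP; have Ip : (chart_map c @` chart_dom c) (chart_map c p) by exists p.
by apply: (chart_inv_cont Ip) => /=; rewrite chart_mapK.
Qed.

Lemma chart_dom_near (c : chart R n M) p : chart_dom c p -> \forall q \near p, chart_dom c q.
Proof. by move=> dp; apply: open_nbhs_nbhs; split => //; exact: chart_dom_open. Qed.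

Lemma transition_differentiable c c' p : A c -> A c' -> chart_dom c p -> chart_dom c' p ->
  differentiable (transition c c') (chart_map c p).
Proof.
move=> Ac Ac' dp dp'.
have [+ _] := manifold_smooth M_manifold Ac Ac' 1%N; apply.
by exists p.
Qed.

(** Independence of the charts: near the point, the two coordinate expressions differ by transition
    maps on both sides. *)
Lemma mdiff_coord c c' h p : mdiff h p -> A c -> A c' -> chart_dom c p ->
  chart_dom c' (h p) -> differentiable (coord c c' h) (chart_map c p).
Proof.
move=> [ch [b [b' [Ab Ab' dp dhp dh]]]] Ac Ac' dp' dhp'.
have d1 := transition_differentiable Ac Ab dp' dp.
have E1 : transition c b (chart_map c p) = chart_map b p by rewrite /transition /= chart_mapK.
have d2 : differentiable (coord b b' h) (transition c b (chart_map c p)) by rewrite E1.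
have d12 := differentiable_comp d1 d2.
have E2 : (coord b b' h \o transition c b) (chart_map c p) = chart_map b' (h p).
  by rewrite /= E1 /coord /= chart_mapK.
have d3 : differentiable (transition b' c') ((coord b b' h \o transition c b) (chart_map c p)).
  by rewrite E2; exact: transition_differentiable.
have d123 := differentiable_comp d12 d3.
apply: (jac_near _ d123).1.
have N : \forall q \near p, chart_dom b q /\ chart_dom b' (h q).
  near=> q; split; near: q; first exact: chart_dom_near.
  by apply: ch; exact: chart_dom_near.
apply: filterS (chart_inv_near dp' N) => x [db db'].
by rewrite /transition /coord /= (chart_mapK db) (chart_mapK db').
Unshelve. all: by end_near. Qed.

Lemma mdiff_comp h h' p : mdiff h p -> mdiff h' (h p) -> mdiff (h' \o h) p.
Proof.
move=> dh dh'; have [ch [c [c1 [Ac Ac1 dp d1 dd]]]] := dh.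
have [ch' [c2 [c' [Ac2 Ac' dp' d' _]]]] := dh'.
split; first exact: continuous_comp.
exists c, c'; split=> //.
have E : coord c c1 h (chart_map c p) = chart_map c1 (h p) by rewrite /coord /= chart_mapK.
have dd' : differentiable (coord c1 c' h') (coord c c1 h (chart_map c p)).
  by rewrite E; exact: mdiff_coord.
apply: (jac_near _ (differentiable_comp dd dd')).1.
have N : \forall q \near p, chart_dom c1 (h q) by apply: ch; exact: chart_dom_near.
by apply: filterS (chart_inv_near dp N) => x d1x; rewrite /coord /= (chart_mapK d1x).
Qed.

Lemma jac_coord_comp c h h' p : A c -> chart_dom c p -> h p = p -> h' p = p ->
  mdiff h p -> mdiff h' p ->
  jac (coord c c (h' \o h)) (chart_map c p) =
    jac (coord c c h) (chart_map c p) *m jac (coord c c h') (chart_map c p).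
Proof.
move=> Ac dp hp h'p dh dh'.
have E : coord c c h (chart_map c p) = chart_map c p by rewrite /coord /= chart_mapK // hp.
have d1 : differentiable (coord c c h) (chart_map c p) by apply: mdiff_coord => //; rewrite hp.
have d2 : differentiable (coord c c h') (coord c c h (chart_map c p)).
  by rewrite E; apply: mdiff_coord => //; rewrite h'p.
have [dd J] := jac_comp d1 d2; rewrite E in J; rewrite -J; symmetry.
have N : \forall q \near p, chart_dom c (h q).
  by apply: dh.1; rewrite hp; exact: chart_dom_near.
apply: (jac_near _ _).2 => //.
- by apply: filterS (chart_inv_near dp N) => x dx; rewrite /coord /= (chart_mapK dx).
- by apply: mdiff_coord => //; [apply: mdiff_comp; rewrite ?hp|rewrite /= hp h'p].
Qed.

Lemma C1_map_mdiff h p : C1_map A h -> mdiff h p.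
Proof.
move=> [ch dh]; split; first exact: ch.
have [c Ac dp] := manifold_cover M_manifold p.
have [c' Ac' dp'] := manifold_cover M_manifold (h p).
by exists c, c'; split=> //; have [+ _] := dh c c' Ac Ac'; apply; exists p.
Qed.

Lemma local_flow_mdiff (p : M) : \forall q \near p & eps \near (0 : R)^'+,
  forall s : R, `|s| <= eps -> mdiff (Phi s) q.
Proof.
have [c Ac dp] := manifold_cover M_manifold p.
have [rho [eps [K box]]] := flow_box_exists Ac dp.
have pr : `|chart_map c p - chart_map c p| < rho by rewrite subrr normr0 (box_rho box).
near=> q e.
have [dq qr] : chart_dom c q /\ `|chart_map c q - chart_map c p| < rho.
  by near: q; exact: chart_ball_nbhs.
have eE : e <= eps by apply: ltW; near: e; apply: nbhs_right_lt; exact: (box_eps box).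
move=> s /= se; have sE := le_trans se eE.
have dd := flow_box_differentiable Ac box dq qr sE.
have [ds _] := box_stay box dq qr sE.
split; last by exists c, c; split.
have Fq : (coord c c (Phi s)) (chart_map c q) = chart_map c (Phi s q).
  by rewrite /coord /= chart_mapK.
(* Near q, [box_stay] keeps [Phi s] in the chart, so it equals this composite and inherits its
   continuity. *)
have cF : {for q, continuous (chart_inv c \o (coord c c (Phi s) \o chart_map c))}.
  apply: continuous_comp.
    apply: continuous_comp; first exact: chart_map_cont.
    exact: differentiable_continuous.
  by rewrite /= Fq; apply: chart_inv_cont; exists (Phi s q).
move=> V; have -> : Phi s q = (chart_inv c \o (coord c c (Phi s) \o chart_map c)) q.
  by rewrite /= Fq chart_mapK.
move=> /cF; have N := chart_ball_nbhs dq qr.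
rewrite /nbhs /= => VF; near=> q'.
have [dq' qr'] : chart_dom c q' /\ `|chart_map c q' - chart_map c p| < rho by near: q'.
have [ds' _] := box_stay box dq' qr' sE.
change (V (Phi s q')); have -> : Phi s q' = (chart_inv c \o (coord c c (Phi s) \o chart_map c)) q'.
  by rewrite /coord /= (chart_mapK dq') (chart_mapK ds').
by near: q'.
Unshelve. all: by end_near. Qed.

(** Compactness makes the short time of [local_flow_mdiff] uniform over M, and [Phi t] is an iterate
    of a short-time map. *)
Lemma flow_mdiff t p : compact [set: M] -> mdiff (Phi t) p.
Proof.
move=> /compact_near_coveringP cM.
have [eps [e0 He]] : exists eps : R, 0 < eps /\
    forall q (s : R), `|s| <= eps -> mdiff (Phi s) q.
  pose P (e : R) (q : M) := forall s : R, `|s| <= e -> mdiff (Phi s) q.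
  have H : \forall e \near (0 : R)^'+, setT `<=` P e.
    by apply: cM => q _; exact: local_flow_mdiff.
  have H2 : \forall e \near (0 : R)^'+, 0 < e /\ setT `<=` P e.
    by near=> e; split; near: e; [exact: nbhs_right_gt|exact: H].
  have [e [e0 He]] := @filter_ex _ _ (at_right_proper_filter 0) _ H2.
  by exists e; split=> // q; exact: He.
pose N := (Num.truncn (`|t| / eps)).+1.
pose s := t / N%:R.
have sE : `|s| <= eps.
  rewrite /s normrM normfV [`|N%:R|]ger0_norm // ler_pdivrMr ?ltr0n // mulrC -ler_pdivrMr //.
  by apply: ltW; exact: truncnS_gt.
suff H k : mdiff (Phi (k%:R * s)) p by have := H N; rewrite /s mulrC divfK ?pnatr_eq0.
elim: k => [|k IH]; first by rewrite mul0r; apply: He; rewrite normr0 ltW.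
have -> : Phi (k.+1%:R * s) = Phi s \o Phi (k%:R * s).
  by apply/funext => q /=; rewrite -(flowD Phi_flow) -nat1r mulrDl mul1r.
by apply: mdiff_comp IH _; exact: He.
Unshelve. all: by end_near. Qed.

(** Continuity of the fixed map [Phi s] at p, followed by a displacement over the time s' - s that
    is bounded uniformly in a flow box around [Phi s p]. *)
Lemma flow_joint_continuous (s : R) p (V : set M) : compact [set: M] -> nbhs (Phi s p) V ->
  \forall s' \near s & q \near p, V (Phi s' q).
Proof.
move=> cM nV; set q := Phi s p in nV *.
have [c Ac dq] := manifold_cover M_manifold q.
have [rho [eps [K box]]] := flow_box_exists Ac dq; set x0 := chart_map c q in box.
have /nbhs_normP[r /= r0 Vr] := chart_inv_near dq nV.
pose C := 2 * (`|local_field c x0| + 2 * K * rho).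
have C0 : 0 <= C by rewrite mulr_ge0 // addr_ge0 // !mulr_ge0 ?(box_K box) ?(ltW (box_rho box)).
pose rho' := Num.min rho (r / 2).
have rho'0 : 0 < rho' by rewrite lt_min (box_rho box) divr_gt0.
have qr : `|chart_map c q - x0| < rho' by rewrite subrr normr0.
have N := chart_ball_nbhs dq qr.
have [cP _] := flow_mdiff s p cM.
pose d := Num.min eps (r / 2 / (C + 1)).
have C1 : 0 < C + 1 by rewrite ltr_wpDl.
have d0 : 0 < d by rewrite lt_min (box_eps box) !divr_gt0.
have N' : \forall z \near p,
    chart_dom c (Phi s z) /\ `|chart_map c (Phi s z) - x0| < rho' := cP _ N.
near=> s' z => /=.
have [dz] : chart_dom c (Phi s z) /\ `|chart_map c (Phi s z) - x0| < rho' by near: z.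
rewrite lt_min => /andP[zr zr2].
have : `|s - s'| < d by near: s'; apply: cvgr_dist_lt => //; exact: cvg_id.
rewrite lt_min distrC => /andP[/ltW se sr].
have -> : Phi s' z = Phi (s' - s) (Phi s z) by rewrite -(flowD Phi_flow) subrK.
have [ds _] := box_stay box dz zr se.
have B := flow_box_speed_bound Ac box dz zr se.
rewrite -(chart_mapK ds); apply: Vr; rewrite /= mx_distrC.
rewrite -(subrK (chart_map c (Phi s z)) (chart_map c (Phi (s' - s) (Phi s z)))) -addrA.
rewrite (le_lt_trans (ler_normD _ _)) // [ltRHS](splitr r) ler_ltD //.
rewrite (le_trans B) //.
have -> : 2 * `|s' - s| * (`|local_field c x0| + 2 * K * rho) = `|s' - s| * C by rewrite /C; ring.
move: sr; rewrite ltr_pdivlMr // => /ltW; apply: le_trans.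
by rewrite ler_wpM2l // lerDl.
Unshelve. all: by end_near. Qed.

(** * Linearization at a point *)

Section FixedPoint.
Context {c : chart R n M} {p : M} {rho eps K : R}.
Hypothesis M_compact : compact [set: M].
Hypothesis Ac : A c.
Hypothesis dp : chart_dom c p.
Let x0 := chart_map c p.
Hypothesis box : flow_box c x0 rho eps K.
Let Y := local_field c.
Let e := Y x0.
Let L (s : R) := jac (coord c c (Phi s)) x0.

Lemma chart_map_inj q : chart_dom c q -> chart_map c q = x0 -> q = p.
Proof. by move=> dq E; rewrite -(chart_mapK dq) E chart_mapK. Qed.

Lemma center_in_box : `|chart_map c p - x0| < rho.
Proof. by rewrite subrr normr0 (box_rho box). Qed.

Lemma velocityE : e = X c p.
Proof. by rewrite /e /Y /local_field /= chart_mapK. Qed.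

Lemma mdiff_jacP h : mdiff h p -> h p = p -> forall eta : R, 0 < eta ->
  \forall q \near p, [/\ chart_dom c q, chart_dom c (h q) &
    `|chart_map c (h q) - x0 - (chart_map c q - x0) *m jac (coord c c h) x0| <=
       eta * `|chart_map c q - x0|].
Proof.
move=> dh hp eta eta0.
have dd : differentiable (coord c c h) x0 by apply: mdiff_coord => //; rewrite hp.
have /differentiable_rVP/(_ eta eta0) H : differentiable (coord c c h) x0 /\
  jac (coord c c h) x0 = jac (coord c c h) x0 by [].
have N : \forall q \near p, `|coord c c h (chart_map c q) - coord c c h x0 -
     (chart_map c q - x0) *m jac (coord c c h) x0| <= eta * `|chart_map c q - x0|.
  exact: (chart_map_cont dp H).
have N2 : \forall q \near p, chart_dom c (h q).
  by apply: dh.1; rewrite hp; exact: chart_dom_near.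
near=> q.
have dq : chart_dom c q by near: q; exact: chart_dom_near.
split=> //; first by near: q.
have : `|coord c c h (chart_map c q) - coord c c h x0 -
    (chart_map c q - x0) *m jac (coord c c h) x0| <= eta * `|chart_map c q - x0|.
  by near: q.
have -> : coord c c h (chart_map c q) = chart_map c (h q) by rewrite /coord /= chart_mapK.
by have -> : coord c c h x0 = x0 by rewrite /coord /= chart_mapK // hp.
Unshelve. all: by end_near. Qed.

(** Commuting with the flow and fixing p, h fixes the orbit of p pointwise; differentiate along that
    orbit at time 0. *)
Lemma jac_fixed_velocity h : mdiff h p -> h p = p ->
  (forall t, h \o Phi t = Phi t \o h) -> e *m jac (coord c c h) x0 = e.
Proof.
move=> dh hp hC.
have [cg dg] := flow_integral Phi_flow p.
pose gamma : R -> 'rV[R]_n := chart_map c \o Phi^~ p.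
have g0 : gamma 0 = x0 by rewrite /gamma /= (flow0 Phi_flow).
have D1 : is_derive (0 : R) 1 gamma e.
  by have := dg c 0 Ac; rewrite (flow0 Phi_flow) -velocityE; apply.
have dd : differentiable (coord c c h) (gamma 0).
  by rewrite g0; apply: mdiff_coord => //; rewrite hp.
have := is_derive_comp_rV D1 dd; rewrite g0 => -[d2 <-].
case: D1 => d1 <-; apply: near_eq_derive.
have N : \forall t \near (0 : R), chart_dom c (Phi t p).
  by apply: cg; rewrite (flow0 Phi_flow); exact: chart_dom_near.
apply: filterS N => t dt; rewrite /gamma /coord /= chart_mapK //.
by have := congr1 (fun k => k p) (hC t); rewrite /= hp => ->.
Qed.

(** * Times that fix p, and the action of their differentials *)

Lemma small_times (P : R -> Prop) : (forall s, `|s| <= eps -> P s) ->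
  (forall s r, P s -> P r -> P (s + r)) -> forall s, P s.
Proof.
move=> small add t; have e0 := box_eps box.
pose N := (Num.truncn (`|t| / eps)).+1.
have sE : `|t / N%:R| <= eps.
  rewrite normrM normfV [`|N%:R|]ger0_norm // ler_pdivrMr ?ltr0n // mulrC -ler_pdivrMr //.
  by apply: ltW; exact: truncnS_gt.
suff H k : P (k%:R * (t / N%:R)) by have := H N; rewrite mulrC divfK ?pnatr_eq0.
elim: k => [|k IH]; first by rewrite mul0r; apply: small; rewrite normr0 ltW.
by rewrite -nat1r mulrDl mul1r; apply: add => //; exact: small.
Qed.

Lemma zero_velocity_fixed s : e = 0 -> Phi s p = p.
Proof.
move=> e0; move: s; apply: small_times => [s sE|s r ps pr].
  have [ds _] := box_stay box dp center_in_box sE.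
  apply: chart_map_inj => //; apply/eqP; rewrite -subr_eq0 -normr_le0.
  have := flow_speed (t := 1) Ac box dp center_in_box sE; rewrite mul1r ler01 lexx.
  by move=> /(_ isT)/le_trans; apply; rewrite -/x0 -/Y -/e e0 normr0 mulr0.
by rewrite (flowD Phi_flow) pr.
Qed.

Lemma stab_jacD s r : Phi s p = p -> Phi r p = p -> L (s + r) = L s *m L r.
Proof.
move=> ps pr; rewrite /L -(jac_coord_comp Ac dp ps pr); try exact: flow_mdiff.
by congr (jac (coord c c _) _); apply/funext => q; rewrite addrC (flowD Phi_flow).
Qed.

Lemma stab_jac0 : L 0 = 1%:M.
Proof.
apply: (proj2 (A := differentiable (coord c c (Phi 0)) x0)); apply/differentiable_rVP => eta eta0.
have N : \forall x \near x0, (chart_map c @` chart_dom c) x.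
  by apply: open_nbhs_nbhs; split; [exact: chart_img_open|exists p].
apply: filterS N => x /chart_invP[dx cx].
rewrite /coord /= !(flow0 Phi_flow) cx chart_mapK // mulmx1 subrr normr0.
by rewrite mulr_ge0 // ltW.
Qed.

(** [flow_expansion] at x0 + h v, divided by h, for small h. It identifies the Jacobian of the field
    as the generator of the maps [L s], in the form that [one_parameter_fixed] takes. *)
Lemma singular_jac_expansion (s : R) (v : 'rV[R]_n) : e = 0 -> `|s| <= eps ->
  `|v *m L s - v - s *: (v *m jac Y x0)| <= 2 * K * `|s| ^+ 2 * `|v *m jac Y x0|.
Proof.
move=> e0 sE; set B := jac Y x0.
have ps := zero_velocity_fixed s e0; have K0 := box_K box.
have Ux0 : (chart_map c @` chart_dom c) x0 by exists p.
apply/ler_addgt0Pr => k k0.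
(* w - 1 is the total coefficient of eta in the error below, so that this error stays below k. *)
pose w := (1 + 2 * K * `|s| ^+ 2 + `|s|) * `|v| + 1.
have w0 : 0 < w by rewrite ltr_wpDl // mulr_ge0 // !addr_ge0 // !mulr_ge0 // exprn_ge0.
pose eta := k / w; have eta0 : 0 < eta by rewrite divr_gt0.
have N1 := mdiff_jacP (flow_mdiff s p M_compact) ps eta0.
have dY : differentiable Y x0 by have [+ _] := field_C1 X_C1 Ac; apply.
have /differentiable_rVP/(_ eta eta0) N2 : differentiable Y x0 /\ jac Y x0 = B by [].
have N3 : \forall q \near p, chart_dom c q /\ `|chart_map c q - x0| < rho.
  by apply: chart_ball_nbhs => //; exact: center_in_box.
have N13 := @filterI _ _ (nbhs_filter p) _ _ N1 N3.
have N4 := chart_inv_near dp N13; rewrite -/x0 in N4.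
have N5 : \forall x \near x0, (chart_map c @` chart_dom c) x.
  by apply: open_nbhs_nbhs; split => //; exact: chart_img_open.
have N42 := @filterI _ _ (nbhs_filter x0) _ _ (@filterI _ _ (nbhs_filter x0) _ _ N4 N5) N2.
have /nbhs_normP[r /= r0 Hr] := N42.
pose h := r / (2 * (`|v| + 1)).
have v1 : 0 < 2 * (`|v| + 1) by rewrite mulr_gt0 // ltr_wpDl.
have h0 : 0 < h by rewrite divr_gt0.
have xr : `|x0 - (x0 + h *: v)| < r.
  rewrite opprD addNKr normrN normrZ gtr0_norm // /h mulrAC ltr_pdivrMr //.
  by rewrite ltr_pM2l //; have := normr_ge0 v; lra.
have [[[[dq ds E1] [_ qr]] /chart_invP[_ cx]] E2] := Hr _ xr.
have E3 := flow_expansion Ac box dq qr sE; move: E1 E2 E3 qr.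
rewrite !cx -/Y -/e -/(L s) e0 subr0 [x0 + _]addrC addrK -!scalemxAl.
set F := chart_map c (Phi s _); set y := Y _; set d := h *: v + x0.
rewrite -/B => E1 E2 E3 _.
have hn (u : 'rV[R]_n) : `|h *: u| = h * `|u| by rewrite normrZ gtr0_norm.
have yB : `|y| <= h * `|v *m B| + eta * (h * `|v|).
  rewrite -(subrK (h *: (v *m B)) y) (le_trans (ler_normD _ _)) // [leLHS]addrC.
  by rewrite hn lerD2l (le_trans E2) // hn.
have E : h *: (v *m L s - v - s *: (v *m B)) =
    - (F - x0 - h *: (v *m L s)) + (F - d - s *: y) + s *: (y - h *: (v *m B)).
  by rewrite /d; apply/rowP => i; rewrite !mxE; ring.
rewrite -(ler_pM2l h0) -hn E.
rewrite (le_trans (ler_normD _ _)) //.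
rewrite (le_trans (lerD (ler_normD _ _) (lexx _))) // normrN normrZ.
rewrite (le_trans (lerD (lerD E1 E3) (ler_wpM2l (normr_ge0 s) E2))) // hn.
have C0 : 0 <= 2 * K * `|s| ^+ 2 by rewrite !mulr_ge0 // exprn_ge0.
rewrite (le_trans (lerD (lerD (lexx _) (ler_wpM2l C0 yB)) (lexx _))) //.
have -> : eta * (h * `|v|) + 2 * K * `|s| ^+ 2 * (h * `|v *m B| + eta * (h * `|v|)) +
    `|s| * (eta * (h * `|v|)) = h * (2 * K * `|s| ^+ 2 * `|v *m B| + eta * (w - 1)).
  by rewrite /w; ring.
rewrite ler_pM2l // lerD2l /eta mulrAC ler_pdivrMr // ler_wpM2l ?(ltW k0) //.
by rewrite gerBl.
Qed.

Lemma stab_opp s : Phi s p = p -> Phi (- s) p = p.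
Proof. by move=> ps; rewrite -{1}ps -(flowD Phi_flow) addNr (flow0 Phi_flow). Qed.

Lemma flowC s r : Phi s \o Phi r = Phi r \o Phi s.
Proof. by apply/funext => q /=; rewrite -!(flowD Phi_flow) addrC. Qed.

Lemma stab_velocity s : Phi s p = p -> e *m L s = e.
Proof. by move=> ps; apply: jac_fixed_velocity => // [|t]; [exact: flow_mdiff|exact: flowC]. Qed.

Lemma stab_jac_natmul s k : Phi s p = p ->
  Phi (k%:R * s) p = p /\ L (k%:R * s) = L s ^+ k.
Proof.
move=> ps; elim: k => [|k [IH1 IH2]]; first by rewrite mul0r (flow0 Phi_flow) stab_jac0.
have E : k.+1%:R * s = k%:R * s + s by rewrite -natr1 mulrDl mul1r.
by rewrite E (flowD Phi_flow) ps IH1 stab_jacD // IH2 exprSr.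
Qed.

(** If s fixes p, the expansion reads |s| |e| <= 2 K |s|^2 |e|, which forces s = 0 as soon as 2 K
    |s| < 1. *)
Lemma small_stab0 : e != 0 -> exists2 d : R, 0 < d &
  forall s, `|s| < d -> Phi s p = p -> s = 0.
Proof.
move=> e0; have K0 := box_K box; have eps0 := box_eps box.
have K1 : 0 < 2 * K + 1 by rewrite ltr_wpDl // mulr_ge0.
exists (Num.min eps (2 * K + 1)^-1); first by rewrite lt_min eps0 invr_gt0.
move=> s; rewrite lt_min => /andP[/ltW sE sK] ps.
have := flow_expansion Ac box dp center_in_box sE; rewrite ps subrr add0r normrN normrZ -/x0 -/Y -/e.
rewrite expr2 !mulrA ler_pM2r ?normr_gt0 // => H.
apply/eqP; rewrite -normr_eq0; apply/negPn/negP => s0.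
have s1 : 0 < `|s| by rewrite lt0r s0 /=.
move: H; rewrite -{1}[`|s|]mul1r ler_pM2r // => H.
have : (2 * K + 1) * `|s| < 1 by rewrite -ltr_pdivlMl // mulr1.
by rewrite mulrDl mul1r; lra.
Qed.

(* Any element of the stabilizer within d of its infimum over the positive ones
   is minimal, as differences of stabilizer elements cannot lie in (0, d). *)
Lemma stab_period s : e != 0 -> Phi s p = p -> 0 < s ->
  exists P (k : nat), [/\ is_period Phi p P, (0 < k)%N & s = k%:R * P].
Proof.
move=> e0 ps s0; have [d d0 small] := small_stab0 e0.
pose S := [set t : R | 0 < t /\ Phi t p = p].
have hS : has_inf S by split; [exists s|exists 0 => t [/ltW]].
have [P [P0 pP] PS] := inf_adherent d0 hS.
have Pmin t : 0 < t < P -> Phi t p <> p.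
  move=> /andP[t0 tP] pt.
  have St : inf S <= t by apply: ge_inf; [case: hS|].
  have pPt : Phi (P - t) p = p by rewrite (flowD Phi_flow) stab_opp.
  have /eqP : P - t = 0 by apply: small => //; rewrite gtr0_norm ?subr_gt0 //; lra.
  by rewrite subr_eq0 gt_eqF.
pose k := Num.truncn (s / P).
have /andP[k1 k2] : k%:R <= s / P < k.+1%:R by apply: truncn_itv; rewrite divr_ge0 // ltW.
have sP : s - k%:R * P = 0.
  apply: contrapT => /eqP r0.
  have r1 : 0 <= s - k%:R * P by rewrite subr_ge0 -ler_pdivlMr.
  apply: (@Pmin (s - k%:R * P)).
    rewrite lt0r r0 r1 /= ltrBlDl -[X in _ + X]mul1r -mulrDl natr1.
    by rewrite -ltr_pdivrMr.
  rewrite (flowD Phi_flow) stab_opp //.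
  by have [] := stab_jac_natmul k pP.
exists P, k; split; [split=> //| |by apply/eqP; rewrite -subr_eq0 sP].
by rewrite lt0n; apply: contra_eqN sP => /eqP->; rewrite mul0r subr0 gt_eqF.
Qed.

(** This is where hyperbolicity enters: through the generator of [L] at a singularity, and otherwise
    through [L s] = ([L P])^k, where P is the minimal period and s = k P. *)
Lemma stab_free s (v : 'rV[R]_n) : all_critical_hyperbolic A X Phi ->
  Phi s p = p -> s != 0 -> (v *m L s - v <= e)%MS -> (v <= e)%MS.
Proof.
move=> [hsing hper] ps s0.
have [e0|e0] := eqVneq e 0.
  have D0 (u : 'rV[R]_n) : (u <= e)%MS = (u == 0).
    by apply/idP/eqP => [/sub_rVP[a ->]|->]; [rewrite e0 scaler0|exact: sub0mx].
  rewrite !D0 subr_eq0 => /eqP vL; apply/eqP.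
  have sing : singularity A X p.
    move=> c' Ac' dp'; rewrite (field_change X_C1 Ac Ac' dp dp') -velocityE e0.
    by rewrite mul0mx.
  have [_ hyp] := hsing p sing.
  apply: (one_parameter_fixed (box_eps box) stab_jac0 _ _ _ s0 vL).
  - by move=> t r; apply: stab_jacD; exact: zero_velocity_fixed.
  - by move=> t w; apply: singular_jac_expansion.
  - by move=> z; have := hyp c z Ac dp; rewrite /complex_eigenvalue unlock; apply.
have pos t : 0 < t -> Phi t p = p -> (v *m L t - v <= e)%MS -> (v <= e)%MS.
  move=> t0 pt /sub_rVP[a va]; have [P [k [perP k0 tE]]] := stab_period e0 pt t0.
  have pP : Phi P p = p by case: perP.
  have [_ /(_ c Ac dp)[mu hyp]] := hper p P perP.
  have JL : 'J (chart_map c \o Phi P \o chart_inv c) (chart_map c p) = L P by rewrite /L unlock.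
  rewrite JL in mu hyp.
  have [|b ->] := @hyperbolic_power_fixed R n (L P) e v k a e0 (stab_velocity pP) mu hyp k0.
    by rewrite -(stab_jac_natmul k pP).2 -tE; apply/eqP; rewrite addrC -subr_eq va.
  exact: scalemx_sub.
move: s0; rewrite neq_lt => /orP[sn|sp]; last exact: pos.
(* Multiplication by [L (- s)], which fixes e, turns the hypothesis into the one for the positive
   time - s. *)
move=> H; have pos' : 0 < - s by rewrite oppr_gt0.
apply: (pos (- s)) => //; first exact: stab_opp.
have := submxMr (L (- s)) H; rewrite mulmxBl -mulmxA -stab_jacD ?subrr ?stab_jac0 ?mulmx1 //; last exact: stab_opp.
by rewrite (stab_velocity (stab_opp ps)) -eqmx_opp opprB.
Qed.

(** * Limit times *)

Section Centralizer.
Context {g : M -> M} {l : 'cV[R]_n}.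
Hypothesis g_mdiff : mdiff g p.
Hypothesis gp : g p = p.
Hypothesis gC : forall t, g \o Phi t = Phi t \o g.
Hypothesis l0 : e = 0 -> l = 0.
Hypothesis l1 : e != 0 -> e *m l = 1%:M.
Let B := jac (coord c c g) x0.
(** The projection along e onto the kernel of the linear form l, a concrete model of the quotient by
    the line of X(p); it is the identity at a singularity. *)
Let proj : 'M[R]_n := 1%:M - l *m e.

Lemma velocity_proj : e *m proj = 0.
Proof.
rewrite mulmxBr mulmx1 mulmxA; have [e0|e0] := eqVneq e 0.
  by rewrite e0 !mulmx0 subr0.
by rewrite l1 // mul1mx subrr.
Qed.

Lemma proj_eq0 (v : 'rV[R]_n) : (v <= e)%MS = (v *m proj == 0).
Proof.
apply/idP/eqP => [/sub_rVP[a ->]|]; first by rewrite -scalemxAl velocity_proj scaler0.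
by rewrite mulmxBr mulmx1 mulmxA => /eqP; rewrite subr_eq0 => /eqP->; exact: submxMl.
Qed.

(* d (B - L s) equals r e up to an error in o(|d|) + O(r) (|r e| + |d|), where
   d = c q - x0; this bounds |r e| by a multiple of |d|, and proj kills e. *)
Lemma key_estimate s : Phi s p = p -> forall eta : R, 0 < eta ->
  \forall q \near p & r \near (0 : R), g q = Phi (s + r) q ->
  `|(chart_map c q - x0) *m (B - L s) *m proj| <= eta * `|chart_map c q - x0|.
Proof.
move=> ps eta eta0; have K0 := box_K box; have eps0 := box_eps box.
pose bB := n%:R * `|B - L s|; pose bL := n%:R * `|L s|; pose bp := n%:R * `|proj|.
have bB0 : 0 <= bB by rewrite mulr_ge0.
have bL0 : 0 <= bL by rewrite mulr_ge0.
have bp0 : 0 <= bp by rewrite mulr_ge0.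
(* With a = |c q - x0|: the velocity at [Phi s q] differs from e by at most k4 a, |r e| is at most
   CE a, and the error w below is at most (2 eta1 + |r| Q) a. *)
pose k4 := K * (bL + 1); have k40 : 0 <= k4 by rewrite mulr_ge0 // addr_ge0.
pose CE := 2 * (bB + 2 + (2 * K + 1) * k4).
have K21 : 0 <= 2 * K + 1 by lra.
have K2k : 0 <= (2 * K + 1) * k4 by exact: mulr_ge0.
have CE0 : 0 <= CE by rewrite /CE; move: ((2 * K + 1) * k4) K2k => ? ?; lra.
pose Q := 2 * K * CE + (2 * K + 1) * k4.
have Q0 : 0 <= Q by rewrite /Q addr_ge0 // mulr_ge0 // mulr_ge0.
pose eta2 := eta / (2 * (bp + 1)).
have eta20 : 0 < eta2 by rewrite divr_gt0 // mulr_gt0 // ltr_wpDl.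
pose eta1 := Num.min 1 (eta2 / 2).
have eta10 : 0 < eta1 by rewrite lt_min ltr01 divr_gt0.
have N1 := mdiff_jacP g_mdiff gp eta10.
have N2 := mdiff_jacP (flow_mdiff s p M_compact) ps eta10.
have N3 : \forall q \near p, chart_dom c (Phi s q) /\ `|chart_map c (Phi s q) - x0| < rho.
  have := chart_ball_nbhs dp center_in_box; rewrite -{1}ps; exact: (flow_mdiff s p M_compact).1.
(* In order: r is within the reach of [flow_expansion], |r|^2 <= |r|, 2 K |r| <= 1/2, and |r| Q <=
   eta2. *)
pose d := Num.min (Num.min eps 1) (Num.min (4 * K + 1)^-1 (eta2 / (Q + 1))).
have d0 : 0 < d.
  rewrite !lt_min eps0 ltr01 invr_gt0 divr_gt0 // ?andbT; first by rewrite ltr_wpDl // mulr_ge0.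
  by rewrite ltr_wpDl.
near=> q r => /= E.
have [dq dgq R1] : [/\ chart_dom c q, chart_dom c (g q) &
    `|chart_map c (g q) - x0 - (chart_map c q - x0) *m B| <= eta1 * `|chart_map c q - x0|].
  by near: q.
have [_ dz R2] : [/\ chart_dom c q, chart_dom c (Phi s q) &
    `|chart_map c (Phi s q) - x0 - (chart_map c q - x0) *m L s| <= eta1 * `|chart_map c q - x0|].
  by near: q.
have [_ zr] : chart_dom c (Phi s q) /\ `|chart_map c (Phi s q) - x0| < rho by near: q.
have : `|r| < d by rewrite -normrN -[- r]add0r; near: r; apply: cvgr_dist_lt => //; exact: cvg_id.
rewrite !lt_min -!andbA => /and4P[/ltW re /ltW r1 rK rQ].
have R3 := flow_expansion Ac box dz zr re.
have Egq : g q = Phi r (Phi s q) by rewrite E addrC (flowD Phi_flow).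
rewrite Egq in R1.
move: R1 R2 R3; set v := chart_map c q - x0; set z := chart_map c (Phi s q) in zr *.
rewrite -/Y; set y := Y z; set F := chart_map c (Phi r _) => R1 R2 R3.
pose a := `|v|; have a0 : 0 <= a by exact: normr_ge0.
have ka0 : 0 <= k4 * a by exact: mulr_ge0.
have K20 : 0 <= 2 * K by exact: mulr_ge0.
have za : `|z - x0| <= (bL + 1) * a.
  rewrite -(subrK (v *m L s) (z - x0)) (le_trans (ler_normD _ _)) // addrC mulrDl mul1r.
  rewrite lerD ?mulmx_norm_le // (le_trans R2) // -[leRHS]mul1r ler_wpM2r //.
  by rewrite ge_min lexx.
have R4 : `|y - e| <= k4 * a.
  rewrite /y /e (le_trans (box_lip box (box_rho_lt box zr) _)) ?subrr ?normr0 //.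
    by rewrite mulr_gt0 // (box_rho box).
  by rewrite /k4 -mulrA ler_wpM2l.
have yn : `|y| <= `|e| + k4 * a.
  by rewrite -(subrK e y) (le_trans (ler_normD _ _)) // addrC lerD2l.
(* The four errors: linearization of g, expansion of the flow over time r, linearization of [Phi s],
   variation of the velocity. *)
pose w := - (F - x0 - v *m B) + (F - z - r *: y) + (z - x0 - v *m L s) + r *: (y - e).
have vw : v *m (B - L s) = r *: e + w.
  by rewrite /w mulmxBr; apply/rowP => i; rewrite !(mxDE, mxNE, mxZE); ring.
pose h := `|r| * `|e|; have h0 : 0 <= h by rewrite mulr_ge0.
have r0 : 0 <= `|r| by [].
have wn : `|w| <= 2 * eta1 * a + (2 * K * `|r| * h + `|r| * (2 * K + 1) * (k4 * a)).
  rewrite /w (le_trans (ler_normD _ _)) // (le_trans (lerD (ler_normD _ _) (lexx _))) //.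
  rewrite (le_trans (lerD (lerD (ler_normD _ _) (lexx _)) (lexx _))) // normrN normrZ.
  rewrite (le_trans (lerD (lerD (lerD R1 R3) R2) (ler_wpM2l r0 R4))) //.
  have C2 : 0 <= 2 * K * `|r| ^+ 2 by rewrite !mulr_ge0 // exprn_ge0.
  have := ler_wpM2l C2 yn; rewrite -/a => H.
  have r2 : `|r| ^+ 2 <= `|r| by rewrite expr2 ler_piMr.
  have H2 : 2 * K * `|r| ^+ 2 * (k4 * a) <= 2 * K * `|r| * (k4 * a).
    by apply: ler_wpM2r => //; apply: ler_wpM2l.
  have -> : 2 * K * `|r| * h = 2 * K * `|r| ^+ 2 * `|e| by rewrite /h; ring.
  move: H H2; rewrite mulrDr.
  set T1 := 2 * K * `|r| ^+ 2 * `|y|; set T2 := 2 * K * `|r| ^+ 2 * `|e|.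
  set T3 := 2 * K * `|r| ^+ 2 * (k4 * a) => H H2.
  have -> : `|r| * (2 * K + 1) * (k4 * a) = 2 * K * `|r| * (k4 * a) + `|r| * (k4 * a) by ring.
  by move: H2; set T4 := 2 * K * `|r| * (k4 * a) => H2; lra.
(* The bound for w itself contains h, but with the coefficient 2 K |r| <= 1/2, so that term is
   absorbed. *)
have hE : h <= CE * a.
  have hh : 2 * K * `|r| * h <= 2^-1 * h.
    rewrite ler_wpM2r //; move: rK; rewrite -[X in _ < X]mul1r ltr_pdivlMr; last by lra.
    rewrite mulrDr mulr1; have -> : `|r| * (4 * K) = 2 * (2 * K * `|r|) by ring.
    by lra.
  have : h <= bB * a + `|w|.
    have -> : h = `|r *: e| by rewrite normrZ.
    have -> : r *: e = v *m (B - L s) - w by rewrite vw addrK.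
    by rewrite (le_trans (ler_normB _ _)) // lerD2r mulmx_norm_le.
  have e1a : eta1 * a <= a by rewrite ler_piMl // ge_min lexx.
  have rk : `|r| * (2 * K + 1) * (k4 * a) <= (2 * K + 1) * k4 * a.
    have H : 0 <= (2 * K + 1) * (k4 * a) by exact: mulr_ge0.
    by rewrite -[leRHS]mulrA -[leLHS]mulrA ler_piMl.
  rewrite /CE; move: wn rk hh e1a; set T1 := _ * (k4 * a); set T2 := 2 * K * `|r| * h.
  have -> : 2 * (bB + 2 + (2 * K + 1) * k4) * a = 2 * (bB * a) + 4 * a + 2 * ((2 * K + 1) * k4 * a).
    by ring.
  rewrite -[2 * eta1 * a]mulrA; lra.
have wf : `|w| <= 2 * eta2 * a.
  rewrite (le_trans wn) //.
  have e12 : 2 * eta1 * a <= eta2 * a.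
    rewrite ler_wpM2r // mulrC -ler_pdivlMr //; by rewrite /eta1 ge_min lexx orbT.
  have K2 : 0 <= 2 * K * `|r| by rewrite !mulr_ge0.
  have := ler_wpM2l K2 hE; set T := 2 * K * `|r| * h => HT.
  have rQ' : `|r| * Q * a <= eta2 * a.
    rewrite ler_wpM2r //; move: rQ; rewrite ltr_pdivlMr; last by rewrite ltr_wpDl.
    by rewrite mulrDr mulr1; lra.
  move: rQ' HT; rewrite /Q.
  have -> : `|r| * (2 * K * CE + (2 * K + 1) * k4) * a =
      2 * K * `|r| * (CE * a) + `|r| * (2 * K + 1) * (k4 * a) by ring.
  rewrite -[2 * eta2 * a]mulrA; lra.
rewrite vw mulmxDl -scalemxAl velocity_proj scaler0 add0r (le_trans (mulmx_norm_le _ _)) // -/bp.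
rewrite (le_trans (ler_wpM2l bp0 wf)) // mulrA ler_wpM2r //.
rewrite /eta2; have -> : bp * (2 * (eta / (2 * (bp + 1)))) = eta * (bp / (bp + 1)).
  have : bp + 1 != 0 by rewrite gt_eqF // ltr_wpDl.
  by move=> ?; field.
by rewrite ler_piMr ?(ltW eta0) // ler_pdivrMr ?ltr_wpDl // mul1r lerDl.
Unshelve. all: by end_near. Qed.

(** At a regular p, the value of l along the orbit of p grows like the time, since l is 1 on e; it
    changes sign on [-d, d], also along orbits close to that of p, and the intermediate value
    theorem applies. *)
Lemma transversal (V : set M) : nbhs p V ->
  \forall q \near p, exists r, [/\ V (Phi r q), chart_dom c (Phi r q) &
     (chart_map c (Phi r q) - x0) *m l = 0].
Proof.
move=> nV; have [e0|e0] := eqVneq e 0.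
  near=> q; exists 0; rewrite (flow0 Phi_flow) l0 // mulmx0; split=> //; near: q => //.
  exact: chart_dom_near.
have K0 := box_K box; have eps0 := box_eps box.
have nW : nbhs (Phi 0 p) (V `&` chart_dom c).
  by rewrite (flow0 Phi_flow); apply: filterI => //; exact: chart_dom_near.
have [[U1 U2] [/= nU1 nU2] sub] := flow_joint_continuous M_compact nW.
have /nbhs_normP[d1 /= d10 Hd1] := nU1.
pose th q (r : R) : R := ((chart_map c (Phi r q) - x0) *m l) 0 0.
pose bl := n%:R * `|l|; have bl0 : 0 <= bl by rewrite mulr_ge0.
have mul_l (v : 'rV[R]_n) : `|(v *m l) 0 0| <= bl * `|v|.
  by rewrite (le_trans (mx_entry_le _ _ _)) // mulmx_norm_le.
pose Q := bl * (2 * K * `|e|); have Q0 : 0 <= Q by rewrite !mulr_ge0.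
have Q1 : 0 < 2 * (Q + 1) by rewrite mulr_gt0 // ltr_wpDl.
(* Times up to d stay in the neighbourhood given by joint continuity and in the box; the last bound
   makes the error of [th p r] against r at most d / 2 at r = d and r = - d. *)
pose d := Num.min (d1 / 2) (Num.min eps (2 * (Q + 1))^-1).
have d0 : 0 < d by rewrite !lt_min divr_gt0 // eps0 invr_gt0.
have d_le1 : d <= d1 / 2 by rewrite ge_min lexx.
have d_le2 : d <= eps by rewrite !ge_min lexx orbT.
have d_le3 : d * (2 * (Q + 1)) <= 1 by rewrite -ler_pdivlMr // div1r !ge_min lexx !orbT.
have thp r : `|r| = d -> `|th p r - r| <= d / 2.
  move=> rd; have rE : `|r| <= eps by rewrite rd.
  have H := flow_expansion Ac box dp center_in_box rE.
  have -> : th p r - r = ((chart_map c (Phi r p) - x0 - r *: e) *m l) 0 0.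
    by rewrite mulmxBl -scalemxAl l1 // !(mxDE, mxNE, mxZE) [1%:M 0 0]mxE mulr1.
  rewrite (le_trans (mul_l _)) // (le_trans (ler_wpM2l bl0 H)) // -/x0 -/Y -/e rd.
  have -> : bl * (2 * K * d ^+ 2 * `|e|) = d * (d * Q) by rewrite /Q; ring.
  by rewrite ler_wpM2l ?(ltW d0) //; lra.
have dW q r : U2 q -> `|r| <= d -> V (Phi r q) /\ chart_dom c (Phi r q).
  move=> Uq rd; apply: (sub (r, q)); split=> //=; apply: Hd1.
  by rewrite /= sub0r normrN (le_lt_trans rd) // (le_lt_trans d_le1) //; lra.
have thq r : `|r| = d -> \forall q \near p, `|th q r - th p r| < d / 2.
  move=> rd; have [_ dr] : V (Phi r p) /\ chart_dom c (Phi r p).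
    by apply: dW; [exact: nbhs_singleton|rewrite rd].
  pose k := d / (2 * (bl + 1)); have b1 : 0 < 2 * (bl + 1) by rewrite mulr_gt0 // ltr_wpDl.
  have k0 : 0 < k by rewrite divr_gt0.
  have B0 : `|chart_map c (Phi r p) - chart_map c (Phi r p)| < k by rewrite subrr normr0.
  have N : \forall q \near p, chart_dom c (Phi r q) /\
      `|chart_map c (Phi r q) - chart_map c (Phi r p)| < k.
    exact: (flow_mdiff r p M_compact).1 _ (chart_ball_nbhs dr B0).
  apply: filterS N => q [_ H].
  have -> : th q r - th p r = ((chart_map c (Phi r q) - chart_map c (Phi r p)) *m l) 0 0.
    by rewrite /th !mulmxBl !(mxDE, mxNE); ring.
  rewrite (le_lt_trans (mul_l _)) //.
  rewrite (@le_lt_trans _ _ (bl * k)) //; first by rewrite ler_wpM2l // ltW.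
  have -> : d / 2 = (bl + 1) * k.
    by rewrite /k; have : bl + 1 != 0 by [rewrite gt_eqF // ltr_wpDl]; move=> ?; field.
  by rewrite ltr_pM2r // ltrDl.
have dd1 : `|d| = d by rewrite gtr0_norm.
have dd2 : `|- d| = d by rewrite normrN.
have N1 := thq _ dd1; have N2 := thq _ dd2.
near=> q.
have Uq : U2 q by near: q.
have t1 : 0 <= th q d.
  have : `|th q d - th p d| < d / 2 by near: q.
  by have := thp _ dd1; rewrite ltr_distl ler_distl => /andP[? _] /andP[? _]; lra.
have t2 : th q (- d) <= 0.
  have : `|th q (- d) - th p (- d)| < d / 2 by near: q.
  by have := thp _ dd2; rewrite ltr_distl ler_distl => /andP[_ ?] /andP[_ ?]; lra.
have le_d : - d <= d by lra.
have ct : {within `[- d, d], continuous (th q)}.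
  apply: derivable_within_continuous => r; rewrite in_itv /= => rd.
  have [_ dr] : V (Phi r q) /\ chart_dom c (Phi r q) by apply: dW => //; rewrite ler_norml.
  have [_ /(_ c r Ac dr) D] := flow_integral Phi_flow q.
  have D' : is_derive r 1 (fun r : R => chart_map c (Phi r q) - x0) (X c (Phi r q) - 0).
    exact: is_deriveB.
  have [dm _] := jac_mulmxr l (chart_map c (Phi r q) - x0).
  by have [] := is_derive_entry 0 0 (is_derive_comp_rV D' dm).
have t12 : Num.min (th q (- d)) (th q d) <= 0 <= Num.max (th q (- d)) (th q d).
  by rewrite ge_min t2 le_max t1 orbT.
have [r rd tr] := IVT le_d ct t12.
move: rd; rewrite in_itv /= -ler_norml => rd; have [Vr dr] := dW q r Uq rd.
exists r; split=> //; apply/matrixP => i j; rewrite !ord1 [RHS]mxE; exact: tr.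
Unshelve. all: by end_near. Qed.

(** g q stays near g p = p while [Phi t' q] stays near [Phi t p], and disjoint neighbourhoods
    separate these two points. *)
Lemma unstable_time t : Phi t p <> p ->
  \forall t' \near t & q \near p, g q <> Phi t' q.
Proof.
move=> /eqP tp; have := manifold_hausdorff M_manifold; rewrite open_hausdorff.
move=> /(_ _ _ tp)[[U V] /= [/set_mem Ut /set_mem Vp] [oU oV /eqP UV]].
have N : nbhs (Phi t p) U by exact: open_nbhs_nbhs.
have NV : \forall q \near p, V (g q) by apply: g_mdiff.1; rewrite gp; exact: open_nbhs_nbhs.
have [[U1 U2] [/= nU1 nU2] sub] := flow_joint_continuous M_compact N.
near=> t' q => /= E.
have Ut' : U1 t' by near: t'.
have Uq : U2 q by near: q.
have : (U `&` V) (g q); last by rewrite UV.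
split; last by near: q.
by rewrite E; exact: (sub (t', q)).
Unshelve. all: by end_near. Qed.

Section Times.
Context {a b : R}.
Hypothesis every : forall q, exists2 s, a <= s <= b & g q = Phi s q.

(** Along the points x0 + h v with h -> 0+, every time t in [a, b] violating the conclusion is
    excluded locally, by [unstable_time] or by [key_estimate]. If all were excluded, compactness
    would leave some point without a time. *)
Lemma direction_time (v : 'rV[R]_n) :
  exists s, [/\ a <= s <= b, Phi s p = p & (v *m B - v *m L s <= e)%MS].
Proof.
apply: contrapT => nex.
pose y (h : R) := chart_inv c (x0 + h *: v).
have y_cvg (P : set M) : nbhs p P -> \forall h \near (0 : R)^'+, P (y h).
  move=> nP; have /nbhs_normP[r /= r0 Hr] := chart_inv_near dp nP.
  have v1 : 0 < `|v| + 1 by rewrite ltr_wpDl.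
  near=> h.
  have hr : h < r / (`|v| + 1) by near: h; apply: nbhs_right_lt; exact: divr_gt0.
  have h0 : 0 < h by near: h; exact: nbhs_right_gt.
  apply: Hr; rewrite /= opprD addNKr normrN normrZ gtr0_norm //.
  move: hr; rewrite ltr_pdivlMr // mulrDr mulr1; lra.
have yE : \forall h \near (0 : R)^'+, chart_map c (y h) = x0 + h *: v.
  have Ux0 : (chart_map c @` chart_dom c) x0 by exists p.
  have /nbhs_normP[r /= r0 Hr] : nbhs x0 (chart_map c @` chart_dom c).
    by apply: open_nbhs_nbhs; split => //; exact: chart_img_open.
  have v1 : 0 < `|v| + 1 by rewrite ltr_wpDl.
  near=> h.
  have hr : h < r / (`|v| + 1) by near: h; apply: nbhs_right_lt; exact: divr_gt0.
  have h0 : 0 < h by near: h; exact: nbhs_right_gt.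
  have [] := @chart_invP _ _ _ c (x0 + h *: v); last by [].
  apply: Hr; rewrite /= opprD addNKr normrN normrZ gtr0_norm //.
  move: hr; rewrite ltr_pdivlMr // mulrDr mulr1; lra.
pose P (h t : R) := g (y h) <> Phi t (y h).
have : \forall h \near (0 : R)^'+, `[a, b]%classic `<=` P h.
  have /compact_near_coveringP := @segment_compact R a b; apply => t; rewrite /= in_itv /= => tab.
  have [pt|npt] := EM (Phi t p = p); last first.
    have [[U1 U2] [/= nU1 nU2] sub] := unstable_time npt.
    have nU2' := y_cvg _ nU2.
    near=> t' h; have Ut' : U1 t' by near: t'.
    have Uh : U2 (y h) by near: h.
    exact: (sub (t', y h)).
  pose k := `|v *m (B - L t) *m proj|.
  have k0 : 0 < k.
    rewrite lt0r normr_ge0 andbT normr_eq0 -proj_eq0 mulmxBr; apply/negP => H.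
    by apply: nex; exists t.
  have v1 : 0 < `|v| + 1 by rewrite ltr_wpDl.
  (* For this eta the key estimate at x0 + h v would read h k <= h k |v| / (|v| + 1), which is
     false. *)
  have eta0 : 0 < k / (`|v| + 1) by rewrite divr_gt0.
  have [[U1 U2] [/= nU1 nU2] sub] := key_estimate pt eta0.
  have nU1' := y_cvg _ nU1.
  have nU2' : \forall t' \near t, U2 (t' - t).
    have : (fun t' : R => t' - t) @ t --> t - t by apply: cvgB; [exact: cvg_id|exact: cvg_cst].
    by rewrite subrr; apply.
  near=> t' h; rewrite /P /=.
  have Ut' : U2 (t' - t) by near: t'.
  have Uh : U1 (y h) by near: h.
  move=> E.
  have h0 : 0 < h by near: h; exact: nbhs_right_gt.
  have := sub (y h, t' - t); rewrite /= [t + _]addrC subrK.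
  have -> : chart_map c (y h) = x0 + h *: v by near: h.
  rewrite [x0 + _]addrC addrK => /(_ _ E) H.
  have : `|h *: v *m (B - L t) *m proj| <= k / (`|v| + 1) * `|h *: v|.
    exact: H.
  rewrite -!scalemxAl !normrZ -/k gtr0_norm // mulrCA ler_pM2l // mulrAC ler_pdivlMr //.
  by rewrite ler_pM2l // gerDl leNgt ltr01.
move=> H; have [h Hh] := @filter_ex _ _ (at_right_proper_filter (0 : R)) _ H.
have [s sab E] := every (y h).
by apply: (Hh s _ E); rewrite /= in_itv.
Unshelve. all: by end_near. Qed.

(** Off the orbit of p, each t other than s is excluded near p: modulo X(p), the differentials of g
    and of [Phi t] then differ by an injective map, which contradicts [key_estimate]. *)
Lemma time_limit : all_critical_hyperbolic A X Phi ->
  exists s, [/\ a <= s <= b, Phi s p = p & forall eta : R, 0 < eta ->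
    \forall q \near p, (forall r, Phi r q <> p) ->
      forall t, a <= t <= b -> g q = Phi t q -> `|t - s| < eta].
Proof.
move=> hyp.
have [s [sab ps star]] : exists s, [/\ a <= s <= b, Phi s p = p &
    forall t (v : 'rV[R]_n), Phi t p = p -> ~~ (v <= e)%MS ->
      (v *m B - v *m L t <= e)%MS -> t = s].
  (* If e spans the whole space there is no transversal direction, [star] is vacuous, and any time
     from [direction_time] will do. *)
  have [[w we]|nw] := EM (exists w : 'rV[R]_n, ~~ (w <= e)%MS); last first.
    have [s [sab ps _]] := direction_time 0; exists s; split=> // t v _ ve.
    by exfalso; apply: nw; exists v.
  have [s [sab ps ws]] := direction_time w; exists s; split=> // t v pt ve vt.
  apply: (@common_time R n (fun s => Phi s p = p) L B e _ stab_jac0 stab_jacD _ stab_velocity _ _ _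
    t s v w pt ps ve we vt ws).
  - by move=> s' r ps' pr; rewrite (flowD Phi_flow) stab_opp.
  - move=> r pr; rewrite /B /L -!jac_coord_comp //; try exact: flow_mdiff.
    by rewrite gC.
  - exact: jac_fixed_velocity.
  - by move=> r u; exact: stab_free.
  - by move=> u; have [r [_ pr ur]] := direction_time u; exists r.
exists s; split=> // eta eta0.
pose P (q : M) (t : R) := (forall r, Phi r q <> p) -> g q = Phi t q -> `|t - s| < eta.
suff H : \forall q \near p, `[a, b]%classic `<=` P q.
  by apply: filterS H => q Hq qp t tab; apply: Hq => //=; rewrite in_itv.
have /compact_near_coveringP := @segment_compact R a b; apply => t _.
have [pt|npt] := EM (Phi t p = p); last first.
  have [[U1 U2] [/= nU1 nU2] sub] := unstable_time npt.
  near=> t' q; have Ut' : U1 t' by near: t'.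
  have Uq : U2 q by near: q.
  by move=> _ E; exfalso; exact: (sub (t', q)) E.
have [->|ts] := eqVneq t s.
  near=> t' q.
  have t's : `|t' - s| < eta.
    by rewrite distrC; near: t'; apply: cvgr_dist_lt => //; exact: cvg_id.
  by [].
(* By [star], the first summand kills only multiples of e; the second restores e when e is nonzero.
   So [N] is invertible, and it agrees with the first summand on the kernel of l. *)
pose N := (B - L t) *m proj + l *m e.
have pp : proj *m proj = proj.
  by rewrite {1}/proj mulmxBl mul1mx -mulmxA velocity_proj mulmx0 subr0.
have uN : N \in unitmx.
  rewrite -row_free_unit; apply: inj_row_free => v vN.
  have vp : v *m (B - L t) *m proj = 0.
    have Np : N *m proj = (B - L t) *m proj.
      by rewrite /N (mulmxDl ((B - L t) *m proj)) -!mulmxA velocity_proj mulmx0 addr0 pp.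
    by rewrite -mulmxA -Np mulmxA vN mul0mx.
  have /sub_rVP[k vk] : (v <= e)%MS.
    apply: contraT => ve; have := star t v pt ve; rewrite -mulmxBr proj_eq0 vp eqxx.
    by move=> /(_ isT)/eqP; rewrite (negPf ts).
  move: vN; rewrite /N mulmxDr mulmxA vp add0r vk -scalemxAl mulmxA.
  have [e0|e0] := eqVneq e 0; first by rewrite e0 scaler0.
  by rewrite l1 // mul1mx.
pose C := n%:R * `|invmx N|.
have C0 : 0 <= C by rewrite mulr_ge0.
have below (v : 'rV[R]_n) : v *m l = 0 -> `|v| <= C * `|v *m (B - L t) *m proj|.
  move=> vl; have -> : v *m (B - L t) *m proj = v *m N.
    by rewrite /N mulmxDr mulmxA [v *m (l *m e)]mulmxA vl mul0mx addr0.
  by rewrite -{1}(mulmxK uN v) mulmx_norm_le.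
have C1 : 0 < 2 * (C + 1) by rewrite mulr_gt0 // ltr_wpDl.
(* Combined with [below], this eta yields |v| <= |v| / 2, so the point reached on the orbit of q is
   p itself. *)
have k0 : 0 < (2 * (C + 1))^-1 by rewrite invr_gt0.
have [[U1 U2] [/= nU1 nU2] sub] := key_estimate pt k0.
have nU2' : \forall t' \near t, U2 (t' - t).
  have : (fun t' : R => t' - t) @ t --> t - t by apply: cvgB; [exact: cvg_id|exact: cvg_cst].
  by rewrite subrr; apply.
have N1 := transversal nU1.
near=> t' q; have U2t : U2 (t' - t) by near: t'.
move=> qp E; exfalso.
have [r [Ur dr rl]] : exists r, [/\ U1 (Phi r q), chart_dom c (Phi r q) &
   (chart_map c (Phi r q) - x0) *m l = 0] by near: q.
apply: (qp r); apply: chart_map_inj => //; apply/eqP; rewrite -subr_eq0 -normr_eq0.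
(* As g commutes with the flow, the time t' of q is also a time of [Phi r q], which lies in the
   transverse hyperplane. *)
have Er : g (Phi r q) = Phi (t + (t' - t)) (Phi r q).
  have := congr1 (fun k => k q) (gC r); rewrite /= => ->; rewrite E [t + _]addrC subrK.
  by rewrite -!(flowD Phi_flow) addrC.
have := sub (Phi r q, t' - t) (conj Ur U2t) Er => /=.
set v := chart_map c (Phi r q) - x0 => Hk.
have := le_trans (below v rl) (ler_wpM2l C0 Hk); rewrite mulrA => Hv.
have C2 : C / (2 * (C + 1)) <= 2^-1.
  by rewrite ler_pdivrMr // mulrA mulVf // mul1r lerDl.
have := le_trans Hv (ler_wpM2r (normr_ge0 v) C2) => {}Hv.
by rewrite eq_le normr_ge0 andbT; lra.
Unshelve. all: by end_near. Qed.

End Times.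
End Centralizer.
End FixedPoint.

(** * From the map fixing p back to f *)

Lemma centralizer_time (f : M -> M) (T : R) p : compact [set: M] ->
  all_critical_hyperbolic A X Phi -> C1_map A f ->
  (forall t, f \o Phi t = Phi t \o f) ->
  (forall q, exists2 t, - T <= t <= T & f q = Phi t q) ->
  exists s, [/\ - T <= s <= T, f p = Phi s p & forall eta : R, 0 < eta ->
    \forall q \near p, (forall r, Phi r q <> p) ->
      forall t, - T <= t <= T -> f q = Phi t q -> `|t - s| < eta].
Proof.
move=> cM hyp f1 fC fT; have [t0 _ fp] := fT p.
have [c Ac dp] := manifold_cover M_manifold p.
have [rho [eps [K box]]] := flow_box_exists Ac dp.
pose g := Phi (- t0) \o f.
have dg : mdiff g p by apply: mdiff_comp; [exact: C1_map_mdiff|exact: flow_mdiff].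
have gp : g p = p by rewrite /g /= fp -(flowD Phi_flow) addNr (flow0 Phi_flow).
have gC t : g \o Phi t = Phi t \o g.
  rewrite /g; apply/funext => q /=; have := congr1 (fun k => k q) (fC t) => /= ->.
  by rewrite -!(flowD Phi_flow) addrC.
pose e := local_field c (chart_map c p).
(* The pseudo-inverse of a nonzero row is a right inverse: a linear form with value 1 on X(p). *)
have [l l0 l1] : exists2 l : 'cV[R]_n, e = 0 -> l = 0 & e != 0 -> e *m l = 1%:M.
  exists (if e == 0 then 0 else pinvmx e); first by move=> ->; rewrite eqxx.
  by move=> /[dup] e0 /negPf->; apply: mulmxVp; rewrite /row_free rank_rV e0.
have gT t q : g q = Phi t q <-> f q = Phi (t + t0) q.
  rewrite /g /=; split => [H|->]; last by rewrite -(flowD Phi_flow) addrC addrK.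
  have := congr1 (Phi t0) H; rewrite -!(flowD Phi_flow) addrN (flow0 Phi_flow) => ->.
  by rewrite addrC.
have every q : exists2 s, - T - t0 <= s <= T - t0 & g q = Phi s q.
  have [s sT fs] := fT q; exists (s - t0); first by rewrite !lerD2r.
  by apply/gT; rewrite subrK.
have [s [sT ps lim]] := time_limit cM Ac dp box dg gp gC l0 l1 every hyp.
exists (s + t0); split.
- by move: sT; rewrite lerBlDr lerBrDr.
- by rewrite addrC (flowD Phi_flow) ps.
move=> eta eta0; apply: filterS (lim eta eta0) => q Hq qp t tT fq.
have := Hq qp (t - t0); rewrite !lerD2r => /(_ tT).
by rewrite opprD [- s - _]addrC addrA; apply; apply/gT; rewrite subrK.
Qed.

End FlowBox.

Theorem proposition1p2 (R : realType) (n : nat) (M : topologicalType)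
    (A : set (chart R n M)) (g : chart R n M -> M -> 'M[R]_n)
    (X : chart R n M -> M -> 'rV[R]_n) (Phi : R -> M -> M) (f : M -> M)
    (M_manifold : smooth_manifold A)
    (M_compact : compact [set: M])
    (M_connected : connected [set: M])
    (g_metric : riemannian_metric A g)
    (X_C1 : C1_vector_field A X)
    (Phi_flow : flow_of A X Phi)
    (X_hyperbolic : all_critical_hyperbolic A X Phi)
    (f_centralizer : C1_centralizer A Phi f)
    (f_close : exists T : R, 0 < T /\
       forall p : M, [set Phi t p | t in `[- T, T]] (f p)) :
  exists tau : M -> R,
    [/\ continuous tau,
        forall (t : R) (x : M), tau (Phi t x) = tau x &
        forall x : M, f x = Phi (tau x) x].
Proof.
have [[f1 _] fC] := f_centralizer.
have [T [T0 fT]] := f_close.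
have {}fT p : exists2 t, - T <= t <= T & f p = Phi t p.
  by have [t /= tT <-] := fT p; exists t => //; move: tT; rewrite in_itv.
pose Q p := [set s | [/\ - T <= s <= T, f p = Phi s p & forall eta : R, 0 < eta ->
    \forall q \near p, (forall r, Phi r q <> p) ->
      forall t, - T <= t <= T -> f q = Phi t q -> `|t - s| < eta]].
have exQ p : exists s, Q p s.
  exact: centralizer_time M_manifold X_C1 Phi_flow f T p M_compact X_hyperbolic f1 fC fT.
have cPhi t p : {for p, continuous (Phi t)}.
  by have [] := flow_mdiff M_manifold X_C1 Phi_flow t p M_compact.
have Qflow r p s : Q p s -> Q (Phi r p) s.
  move=> [sT fs lim]; split=> //.
    have := congr1 (fun k => k p) (fC r) => /= ->.
    by rewrite fs -!(flowD Phi_flow) addrC.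
  move=> eta eta0; have back : Phi (- r) (Phi r p) = p.
    by rewrite -(flowD Phi_flow) addNr (flow0 Phi_flow).
  have pull (P : set M) : nbhs p P -> \forall q \near Phi r p, P (Phi (- r) q).
    by move=> nP; apply: cPhi; rewrite back.
  apply: filterS (pull _ (lim eta eta0)) => q Hq qp t tT fq; apply: Hq => // [u|].
    rewrite -(flowD Phi_flow) => E; apply: (qp (r + (u - r))).
    by rewrite (flowD Phi_flow) E.
  have := congr1 (fun k => k q) (fC (- r)) => /= ->.
  by rewrite fq -!(flowD Phi_flow) addrC.
(* [Q p] may contain several times, for instance when all points near p lie on its orbit. [xget]
   depends only on the set, so equality of the sets [Q] along an orbit makes tau exactly
   invariant. *)
pose tau p := xget 0 (Q p).
have tauP p : Q p (tau p) by apply: xgetPex; exact: exQ.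
have tau_flow t p : tau (Phi t p) = tau p.
  congr (xget 0 _); apply/seteqP; split=> s; last exact: Qflow.
  by move=> /(Qflow (- t)); rewrite -(flowD Phi_flow) addNr (flow0 Phi_flow).
exists tau; split=> // [p|p]; last by have [] := tauP p.
apply/cvgrPdist_lt => eta eta0; have [_ _ lim] := tauP p.
apply: filterS (lim eta eta0) => q Hq; rewrite distrC.
(* On the orbit of p the limit property says nothing, but there tau is constant; elsewhere tau q is
   one of the times that tend to tau p. *)
have [[r rq]|nq] := EM (exists r, Phi r q = p).
  by rewrite -rq tau_flow subrr normr0.
have [qT fq _] := tauP q; apply: Hq => // r rq.
by apply: nq; exists r.
Qed.
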